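(* Let $G$ be a group of cohomological dimension $2$ (over $\mathbb{Z}$). Then the following are equivalent. \begin{enumerate} \item $G$ is algebraically hyperbolic (AH). \item $G$ is weakly algebraically hyperbolic (weakly AH). \item $G$ is $\mathrm{BS}$-free. \end{enumerate}
   Context: A group is locally cyclic if each of its non-trivial finitely generated subgroups is isomorphic to $\mathbb{Z}$ (equivalently, it is isomorphic to a subgroup of $(\mathbb{Q},+)$). A group $G$ is commutative-transitive if for all $g,h,k\in G\smallsetminus\{1\}$, $[g,h]=1$ and $[h,k]=1$ imply $[g,k]=1$. A torsion-free group $G$ is algebraically hyperbolic (AH) if (a) $G$ is commutative-transitive, and (b) $G$ contains no subgroup of the form $H\rtimes\mathbb{Z}$ with $H$ non-trivial locally cyclic. A group $G$ is weakly algebraically hyperbolic (weakly AH) if it contains no subgroup isomorphic to $\mathbb{Z}^2$ and for every non-trivial $x\in G$ and all $m,n\in\mathbb{Z}$, if $x^m$ and $x^n$ are conjugate in $G$ then $|m|=|n|$. A group is $\mathrm{BS}$-free if it contains no subgroup isomorphic to a Baumslag--Solitar group $\mathrm{BS}(m,n)=\langle a,t\mid t^{-1}a^mt=a^n\rangle$, $m,n\in\mathbb{Z}\smallsetminus\{0\}$. *)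

(* Defs.v *)
(* Groups are [groupType]s, with no finiteness assumption; the choice structure
   they carry is no restriction, since [boolp] provides one on every type.
   Subgroups are Prop-valued predicates ([set G]). *)
From HB Require Import structures.
From mathcomp Require Import all_boot all_order all_algebra.
From mathcomp Require Import generic_quotient boolp classical_sets.

Set Implicit Arguments.
Unset Strict Implicit.
Unset Printing Implicit Defensive.

Import GRing.Theory.

Local Open Scope classical_set_scope.
Local Open Scope group_scope.

Notation group_hom := UMagmaMorphism.type (only parsing).

Section Subgroups.
Variable G : groupType.

Definition is_subgroup (H : set G) : Prop :=
  H 1 /\ (forall x y, H x -> H y -> H (x / y)).

Definition finitely_generated (H : set G) : Prop :=
  exists s : seq G, H = smallest is_subgroup [set` s].

Definition isomorphic_to (H : set G) (K : groupType) : Prop :=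
  exists f : group_hom K G, injective f /\ range f = H.

Definition contains_subgroup (K : groupType) : Prop :=
  exists H : set G, is_subgroup H /\ isomorphic_to H K.

Definition torsion_free : Prop :=
  forall (x : G) (n : nat), x ^+ n.+1 = 1 -> x = 1.

Definition expgz (x : G) (m : int) : G :=
  match m with Posz n => x ^+ n | Negz n => x ^- n.+1 end.

Definition conjugate (x y : G) : Prop := exists g : G, x ^ g = y.

Definition commutative_transitive : Prop :=
  forall g h k : G, g <> 1 -> h <> 1 -> k <> 1 ->
    [~ g, h] = 1 -> [~ h, k] = 1 -> [~ g, k] = 1.

End Subgroups.

(* The infinite cyclic group, written multiplicatively. *)
Notation Zgroup := (Algebra.to_multiplicative int).

Definition nontrivial (G : groupType) : Prop := exists x : G, x <> 1.

Definition locally_cyclic (G : groupType) : Prop :=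
  forall H : set G, is_subgroup H -> finitely_generated H -> H <> [set 1] ->
    isomorphic_to H Zgroup.

(* A homomorphism K -> Aut(H): each [aut_act k] is an automorphism of H, with
   inverse [aut_act k^-1]. *)
Record aut_action (K H : groupType) := AutAction {
  aut_act :> K -> group_hom H H;
  aut_act1 : forall x, aut_act 1 x = x;
  aut_actM : forall k l x, aut_act (k * l) x = aut_act k (aut_act l x)
}.

Definition sdprod_of (K H : groupType) (phi : aut_action K H) : Type :=
  (H * K)%type.

Section SemidirectProduct.
Variables (K H : groupType) (phi : aut_action K H).
Local Notation S := (sdprod_of phi).

HB.instance Definition _ := Choice.copy S (H * K)%type.

Definition sd_mul (u v : S) : S := (u.1 * phi u.2 v.1, u.2 * v.2).
Definition sd_one : S := (1, 1).
Definition sd_inv (u : S) : S := (phi u.2^-1 u.1^-1, u.2^-1).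

Fact sd_mulA : associative sd_mul.
Proof. by move=> u v w; rewrite /sd_mul /= gmulfM aut_actM !mulgA. Qed.
Fact sd_mul1g : left_id sd_one sd_mul.
Proof. by case=> x k; rewrite /sd_mul /= aut_act1 !mul1g. Qed.
Fact sd_mulVg : left_inverse sd_one sd_inv sd_mul.
Proof.
by case=> x k; rewrite /sd_mul /= -gmulfM !mulVg gmulf1.
Qed.
Fact sd_mulgV : right_inverse sd_one sd_inv sd_mul.
Proof.
by case=> x k; rewrite /sd_mul /= -aut_actM !mulgV aut_act1 mulgV.
Qed.
Fact sd_mulg1 : right_id sd_one sd_mul.
Proof. by case=> x k; rewrite /sd_mul /= gmulf1 !mulg1. Qed.

HB.instance Definition _ :=
  isGroup.Build S sd_mulA sd_mul1g sd_mulg1 sd_mulVg sd_mulgV.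

End SemidirectProduct.

(* Words in the letters x and x^-1, for x in X; the letter (x, false) is x and
   (x, true) is x^-1. *)
Definition word (X : Type) := seq (X * bool).

Definition letterV (X : Type) (l : X * bool) : X * bool := (l.1, ~~ l.2).
Definition wordV (X : Type) (w : word X) : word X := rev (map (@letterV X) w).

Definition gen_exp (X : Type) (x : X) (m : int) : word X :=
  match m with
  | Posz n => nseq n (x, false)
  | Negz n => nseq n.+1 (x, true)
  end.

(* The group < X | u = v, (u, v) in R >: words modulo the least congruence that
   contains R and the free cancellations. *)
Inductive pres_eq (X : choiceType) (R : seq (word X * word X)) :
    word X -> word X -> Prop :=
  | PresRefl u : pres_eq R u u
  | PresSym u v : pres_eq R u v -> pres_eq R v u
  | PresTrans u v w : pres_eq R u v -> pres_eq R v w -> pres_eq R u w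
  | PresCat u u' v v' :
      pres_eq R u u' -> pres_eq R v v' -> pres_eq R (u ++ v) (u' ++ v')
  | PresCancel l : pres_eq R [:: l; letterV l] [::]
  | PresRel u v : (u, v) \in R -> pres_eq R u v.

Section PresentedGroup.
Variables (X : choiceType) (R : seq (word X * word X)).

Definition pres_eqb (u v : word X) : bool := `[< pres_eq R u v >].

Fact pres_eqb_refl : reflexive pres_eqb.
Proof. by move=> u; apply/asboolP; exact: PresRefl. Qed.
Fact pres_eqb_sym : symmetric pres_eqb.
Proof. by move=> u v; apply/asboolP/asboolP; exact: PresSym. Qed.
Fact pres_eqb_trans : transitive pres_eqb.
Proof.
move=> v u w /asboolP uv /asboolP vw; apply/asboolP; exact: PresTrans uv vw.
Qed.

Canonical pres_equiv : equiv_rel (word X) :=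
  EquivRel pres_eqb pres_eqb_refl pres_eqb_sym pres_eqb_trans.

Local Open Scope quotient_scope.

Definition presented : Type := {eq_quot pres_equiv}.
HB.instance Definition _ := Choice.on presented.

Definition pres_class (u : word X) : presented := \pi_({eq_quot pres_equiv}) u.
Definition pres_word (x : presented) : word X := repr (x : {eq_quot pres_equiv}).

Lemma pres_wordK : cancel pres_word pres_class.
Proof. exact: reprK. Qed.
Lemma pres_classP (u v : word X) :
  pres_class u = pres_class v <-> pres_eq R u v.
Proof.
split; first by move/eqquotP/asboolP.
by move=> uv; apply/eqquotP/asboolP.
Qed.

Definition pres_mul (x y : presented) := pres_class (pres_word x ++ pres_word y).
Definition pres_one : presented := pres_class [::].
Definition pres_inv (x : presented) := pres_class (wordV (pres_word x)).

Fact pres_word_class u : pres_eq R (pres_word (pres_class u)) u.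
Proof. by apply/pres_classP; rewrite pres_wordK. Qed.

Fact pres_mulE u v : pres_mul (pres_class u) (pres_class v) = pres_class (u ++ v).
Proof. by apply/pres_classP/PresCat; exact: pres_word_class. Qed.

Fact pres_mulA : associative pres_mul.
Proof.
move=> x y z; rewrite -[x]pres_wordK -[y]pres_wordK -[z]pres_wordK.
by rewrite !pres_mulE catA.
Qed.
Fact pres_mul1 : left_id pres_one pres_mul.
Proof. by move=> x; rewrite -[x]pres_wordK pres_mulE. Qed.
Fact pres_mulr1 : right_id pres_one pres_mul.
Proof. by move=> x; rewrite -[x]pres_wordK pres_mulE cats0. Qed.

Fact letterVK : involutive (@letterV X).
Proof. by case=> x b; rewrite /letterV /= negbK. Qed.
Fact wordVK : involutive (@wordV X).
Proof.
by move=> w; rewrite /wordV map_rev revK -map_comp map_id_in // => l _ /=;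
  exact: letterVK.
Qed.
Fact pres_catV w : pres_eq R (w ++ wordV w) [::].
Proof.
elim: w => [|l w IHw]; first exact: PresRefl.
have -> : (l :: w) ++ wordV (l :: w) =
    [:: l] ++ ((w ++ wordV w) ++ [:: letterV l]).
  by rewrite /wordV /= rev_cons -cats1 catA.
apply: PresTrans (PresCancel R l); rewrite -(cat1s l [:: _]).
apply: PresCat; first exact: PresRefl.
by apply: (PresCat IHw); exact: PresRefl.
Qed.
Fact pres_mulV : left_inverse pres_one pres_inv pres_mul.
Proof.
move=> x; rewrite -{2}[x]pres_wordK pres_mulE; apply/pres_classP.
by rewrite -{2}[pres_word x]wordVK; exact: pres_catV.
Qed.
Fact pres_mulrV : right_inverse pres_one pres_inv pres_mul.
Proof.
move=> x; rewrite -{1}[x]pres_wordK pres_mulE; apply/pres_classP.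
exact: pres_catV.
Qed.

HB.instance Definition _ :=
  isGroup.Build presented pres_mulA pres_mul1 pres_mulr1 pres_mulV pres_mulrV.

End PresentedGroup.

(* < a, t | t^-1 a^m t = a^n >, on the generators a = false and t = true. *)
Definition baumslag_solitar (m n : int) : groupType :=
  let a := gen_exp false in let t := gen_exp true in
  presented [:: (t (-1)%R ++ a m ++ t 1%R, a n)].

Definition algebraically_hyperbolic (G : groupType) : Prop :=
  [/\ torsion_free G, commutative_transitive G &
      ~ exists (H : groupType) (phi : aut_action Zgroup H),
          [/\ nontrivial H, locally_cyclic H &
              contains_subgroup G (sdprod_of phi)]].

Definition weakly_algebraically_hyperbolic (G : groupType) : Prop :=
  ~ contains_subgroup G (Zgroup * Zgroup)%type /\
  forall x : G, x <> 1 -> forall m n : int,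
    conjugate (expgz x m) (expgz x n) -> `|m|%R = `|n|%R.

Definition BS_free (G : groupType) : Prop :=
  ~ exists m n : int,
      [/\ m <> 0%R, n <> 0%R & contains_subgroup G (baumslag_solitar m n)].

(* Left ZG-modules, presented as abelian groups on which G acts by additive
   maps; the action of the group ring is the Z-linear extension. *)
Record gmodule (G : groupType) := GModule {
  gmod_sort :> zmodType;
  gmod_act : G -> {additive gmod_sort -> gmod_sort};
  gmod_act1 : forall v, gmod_act 1 v = v;
  gmod_actM : forall g h v, gmod_act (g * h) v = gmod_act g (gmod_act h v)
}.

Record gmod_hom (G : groupType) (M N : gmodule G) := GModHom {
  gmod_hom_fun :> {additive M -> N};
  gmod_homJ : forall g v,
    gmod_hom_fun (gmod_act M g v) = gmod_act N g (gmod_hom_fun v)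
}.

Section CohomologicalDimension.
Variable G : groupType.

Definition trivial_gmodule : gmodule G :=
  @GModule G int (fun _ => idfun) (fun _ => erefl) (fun _ _ _ => erefl).

Definition surjective (A B : Type) (f : A -> B) : Prop :=
  forall y, exists x, f x = y.

Definition projective (P : gmodule G) : Prop :=
  forall (M N : gmodule G) (p : gmod_hom M N) (f : gmod_hom P N),
    surjective p -> exists h : gmod_hom P M, forall v, p (h v) = f v.

(* A projective resolution  ... -> P 1 -> P 0 -> Z -> 0  over ZG with
   P i = 0 for i > n. *)
Definition cd_le (n : nat) : Prop :=
  exists (P : nat -> gmodule G) (d : forall i, gmod_hom (P i.+1) (P i))
         (eps : gmod_hom (P 0%N) trivial_gmodule),
    [/\ forall i, projective (P i),
        surjective eps,
        forall x, eps x = 0%R <-> exists y, d 0%N y = x,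
        forall i x, d i x = 0%R <-> exists y, d i.+1 y = x &
        forall i, (n < i)%N -> forall x : P i, x = 0%R].

Definition cohomological_dimension (n : nat) : Prop :=
  cd_le n /\ forall m, cd_le m -> (n <= m)%N.

End CohomologicalDimension.

(* Main.v *)
Require Import Defs.
From HB Require Import structures.
From mathcomp Require Import all_boot all_order all_algebra.
From mathcomp Require Import generic_quotient boolp classical_sets.
From mathcomp Require Import zify.
From mathcomp.multinomials Require Import freeg.

(** Two of the three implications are group theory. In an algebraically hyperbolic
    group the centralizer [C] of [x] is locally cyclic; an element conjugating a
    non-trivial power of [x] to another one normalizes [C], and since it does not span a
    semidirect product with [C], it centralizes [x] ([AH_weakly_AH]). A
    Baumslag-Solitar group contains conjugate powers of an element, and contains a
    free abelian group of rank 2 if the exponents agree up to sign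
    ([weakly_AH_BS_free]).

    The dimension is used for the third implication, through a projective resolution
    [P2 -> P1 -> P0 -> Z]. It restricts to subgroups ([restrict_resolution]), and
    dimension shifting over a finite cyclic group shows that [G] is torsion-free
    ([resolution_torsion_free]).

    For commutative transitivity, let [K] be generated by three elements, one of which,
    [h], is central in [K]. As [BS(1, 1)] does not embed, [Q = K / <h>] is a torsion
    group. If [Q] is finite, the transfer embeds [K] into the integers
    ([finite_central_quotient_abelian]). If [Q] is infinite, it has one end, because a
    finitely generated group with more ends contains elements of infinite order
    ([one_end]); hence [H^1(Q, F) = 0] for all free modules [F] ([derivation_inner]).
    Since [h - 1] is regular on free modules over [K], with quotient free over [Q], and
    null-homotopic on the resolution, [H^n(K, F) = H^(n-1)(Q, F / (h - 1))] vanishes for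
    [n = 2] and for [n = 1]. This splits the resolution step by step, and finally makes
    the trivial module a submodule of a free one, which is absurd for an infinite group
    ([central_torsion_absurd]).

    For semidirect products, let [L] be generated by an element [a] of the locally
    cyclic factor and by a generator [t] of the infinite cyclic one, and put
    [a_i = t^i a t^-i]. The relation module of [L] is projective
    ([relation_module_projective]). It has rank one, and a projective module of rank one
    is finitely generated ([relation_module_fg]). Now a sum of coefficients over the
    subgroup [<a_1, ..., a_s>] vanishes on all relations that are short with respect to
    [t], but not on the relation which says that [a_0] and [a_(s+1)] commute, unless
    [a_0] or [a_(s+1)] lies in that subgroup; for large [s] this must be the case
    ([a_in_conjugates]). As [<a_1, ..., a_s>] is cyclic, [t] or its inverse conjugates
    its generator to a power of the generator, so that some [BS(1, n)] embeds in [L]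
    ([no_invariant_cyclic]). *)

Set Implicit Arguments.
Unset Strict Implicit.
Unset Printing Implicit Defensive.
Import Order.TTheory GRing.Theory Num.Theory.
Local Open Scope classical_set_scope.
Local Open Scope group_scope.

(** * Homomorphisms *)

Section Homs.
Variables (G H : groupType) (f : G -> H).
Hypothesis fM : {morph f : x y / x * y}.

Lemma morph1 : f 1 = 1.
Proof. by apply: (@mulgI _ (f 1)); rewrite -fM !mulg1. Qed.

Let fun_of_morph of {morph f : x y / x * y} := f.
HB.instance Definition _ :=
  isMultiplicative.Build G H (fun_of_morph fM) fM.
HB.instance Definition _ :=
  Multiplicative_isUMagmaMorphism.Build G H (fun_of_morph fM) morph1.

Definition hom_of_morph : group_hom G H := fun_of_morph fM.
Lemma hom_of_morphE : hom_of_morph =1 f.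
Proof. by []. Qed.
End Homs.

Definition comp_hom (G H K : groupType) (g : group_hom H K) (f : group_hom G H) :
  group_hom G K := g \o f.

(** * Integer powers *)

Section IntegerPowers.
Variable G : groupType.
Implicit Types (x y g : G) (m n : int).

Lemma expgz1 x : expgz x 1 = x. Proof. by []. Qed.
Lemma expgzN1 x : expgz x (-1) = x^-1. Proof. by []. Qed.

Lemma expgzSr x m : expgz x (m + 1)%R = expgz x m * x.
Proof.
case: m => [n|[|n]].
- by rewrite -PoszD addn1 /= expgSr.
- by rewrite /= expg1 mulVg.
- have -> : (Negz n.+1 + 1)%R = Negz n by rewrite !NegzE; lia.
  by rewrite /= [in RHS]expgS invgM mulgVK.
Qed.

Lemma expgzD x m n : expgz x (m + n)%R = expgz x m * expgz x n.
Proof.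
elim/int_rec: n => [|n IHn|n IHn]; first by rewrite addr0 mulg1.
- by rewrite -addn1 PoszD addrA !expgzSr IHn mulgA.
- apply: (@mulIg _ x); rewrite -mulgA -!expgzSr -addn1 PoszD opprD -!addrA.
  by rewrite addNr addr0 IHn.
Qed.

Lemma expgzN x m : expgz x (- m) = (expgz x m)^-1.
Proof. by apply: (@mulIg _ (expgz x m)); rewrite -expgzD addNr mulVg. Qed.

Lemma expgzM x m n : expgz x (m * n)%R = expgz (expgz x m) n.
Proof.
elim/int_rec: n => [|n IHn|n IHn]; first by rewrite mulr0.
- by rewrite -addn1 PoszD mulrDr mulr1 !expgzD IHn.
- by rewrite -addn1 PoszD opprD mulrDr mulrN1 !expgzD IHn (expgzN x m).
Qed.

Lemma expgzJ x g n : expgz x n ^ g = expgz (x ^ g) n.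
Proof. by case: n => n /=; rewrite ?conjVg conjXg. Qed.

Lemma commute_expgz x y n : commute x y -> commute x (expgz y n).
Proof.
by case: n => n cxy; rewrite /expgz; [|apply: commuteV]; exact: commuteX.
Qed.

Lemma commute_expgz2 x y m n :
  commute x y -> commute (expgz x m) (expgz y n).
Proof.
move=> cxy; apply: commute_expgz; apply: commute_sym; apply: commute_expgz.
exact: commute_sym.
Qed.

Lemma expgzMn x y n : commute x y -> expgz (x * y) n = expgz x n * expgz y n.
Proof.
move=> cxy; case: n => n; rewrite /expgz expgMn //.
rewrite invgM.
apply: commute_sym; apply: commuteV; apply: commute_sym; apply: commuteV.
exact: commuteX2.
Qed.

Lemma expgzVn x n : expgz x^-1 n = (expgz x n)^-1.
Proof. by rewrite -[x^-1](expgzN1 x) -expgzM mulN1r expgzN. Qed.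

Lemma expgz1n n : expgz 1 n = 1 :> G.
Proof. by case: n => n /=; rewrite expg1n ?invg1. Qed.

Definition expgz_hom x : group_hom Zgroup G :=
  @hom_of_morph Zgroup G (expgz x) (expgzD x).

Lemma torsion_free_expgz x n :
  torsion_free G -> expgz x n = 1 -> x = 1 \/ n = 0%R.
Proof.
move=> tf; case: n => [[|n]|n] /=; [by right| |].
  by move/tf; left.
by move/eqP; rewrite invg_eq1 => /eqP/tf; left.
Qed.

Lemma expgz_inj x : torsion_free G -> x <> 1 -> injective (expgz x).
Proof.
move=> tf x1 m n emn; apply/eqP; rewrite -subr_eq0; apply/eqP.
have : expgz x (m - n)%R = 1 by rewrite expgzD expgzN emn mulgV.
by case/(torsion_free_expgz tf).
Qed.

End IntegerPowers.

Lemma hom_expgz (G H : groupType) (f : group_hom G H) x n :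
  f (expgz x n) = expgz (f x) n.
Proof. by case: n => n; rewrite /expgz ?gmulfV gmulfXn. Qed.

(** * Subgroups *)

Section SubgroupType.
Variables (G : groupType) (H : set G).
Hypothesis Hgrp : is_subgroup H.

Lemma subgroup1 : H 1. Proof. by case: Hgrp. Qed.
Lemma subgroupF x y : H x -> H y -> H (x / y).
Proof. by case: Hgrp => _; apply. Qed.
Lemma subgroupV x : H x -> H x^-1.
Proof. by move=> Hx; rewrite -div1g; apply: subgroupF => //; exact: subgroup1. Qed.
Lemma subgroupM x y : H x -> H y -> H (x * y).
Proof. by move=> Hx Hy; rewrite -[y]invgK; apply/subgroupF/subgroupV. Qed.
Lemma subgroupX x n : H x -> H (x ^+ n).
Proof.
move=> Hx; elim: n => [|n IHn]; first exact: subgroup1.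
by rewrite expgS; exact: subgroupM.
Qed.
Lemma subgroupXz x n : H x -> H (expgz x n).
Proof. by move=> Hx; case: n => n; rewrite /expgz; [|apply: subgroupV];
  exact: subgroupX. Qed.

Definition subgroup_type of is_subgroup H : Type := {x : G | `[< H x >]}.
Local Notation S := (subgroup_type Hgrp).
HB.instance Definition _ := Choice.on S.

Lemma subgroup_typeP (u : S) : H (sval u).
Proof. by apply/asboolP; case: u. Qed.
Definition subgroup_elt x (Hx : H x) : S := exist _ x (asboolT Hx).

Lemma subgroup_type_eq (u v : S) : sval u = sval v -> u = v.
Proof.
case: u v => [x Hx] [y Hy] /= eq_xy; case: y / eq_xy Hy => Hy.
by congr exist; exact: bool_irrelevance.
Qed.

Definition subgroup_mul (u v : S) : S :=
  subgroup_elt (subgroupM (subgroup_typeP u) (subgroup_typeP v)).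
Definition subgroup_inv (u : S) : S :=
  subgroup_elt (subgroupV (subgroup_typeP u)).

Fact subgroup_mulA : associative subgroup_mul.
Proof. by move=> u v w; apply: subgroup_type_eq; rewrite /= mulgA. Qed.
Fact subgroup_mul1 : left_id (subgroup_elt subgroup1) subgroup_mul.
Proof. by move=> u; apply: subgroup_type_eq; rewrite /= mul1g. Qed.
Fact subgroup_mulr1 : right_id (subgroup_elt subgroup1) subgroup_mul.
Proof. by move=> u; apply: subgroup_type_eq; rewrite /= mulg1. Qed.
Fact subgroup_mulV :
  left_inverse (subgroup_elt subgroup1) subgroup_inv subgroup_mul.
Proof. by move=> u; apply: subgroup_type_eq; rewrite /= mulVg. Qed.
Fact subgroup_mulrV :
  right_inverse (subgroup_elt subgroup1) subgroup_inv subgroup_mul.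
Proof. by move=> u; apply: subgroup_type_eq; rewrite /= mulgV. Qed.

HB.instance Definition _ := isGroup.Build S subgroup_mulA subgroup_mul1
  subgroup_mulr1 subgroup_mulV subgroup_mulrV.

Definition subgroup_incl : group_hom S G :=
  @hom_of_morph S G (fun u => sval u) (fun _ _ => erefl).

Lemma subgroup_incl_inj : injective subgroup_incl.
Proof. exact: subgroup_type_eq. Qed.

End SubgroupType.

Lemma is_subgroup_range (G K : groupType) (f : group_hom K G) :
  is_subgroup (range f).
Proof.
split; first by exists 1 => //; rewrite gmulf1.
by move=> _ _ [x _ <-] [y _ <-]; exists (x / y) => //; rewrite gmulfF.
Qed.

Lemma contains_subgroupP (G K : groupType) :
  contains_subgroup G K <-> exists f : group_hom K G, injective f.
Proof.
split=> [[H [_ [f [f_inj _]]]]|[f f_inj]]; first by exists f.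
by exists (range f); split; [exact: is_subgroup_range | exists f].
Qed.

Lemma contains_subgroup_trans (G K L : groupType) :
  contains_subgroup G K -> contains_subgroup K L -> contains_subgroup G L.
Proof.
move=> /contains_subgroupP[f f_inj] /contains_subgroupP[g g_inj].
by apply/contains_subgroupP; exists (comp_hom f g); exact: inj_comp.
Qed.

Section Generation.
Variable G : groupType.

Definition gen (A : set G) : set G := smallest (@is_subgroup G) A.

Lemma gen_subgroup (A : set G) : is_subgroup (gen A).
Proof.
split=> [H [[]]//|x y Ax Ay H [Hgrp AH]].
by apply: (subgroupF Hgrp); [apply: Ax | apply: Ay].
Qed.

Lemma gen1 (A : set G) : gen A 1.
Proof. by move=> H [[]]. Qed.

Lemma sub_gen (A : set G) : A `<=` gen A.
Proof. exact: sub_smallest. Qed.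

Lemma gen_min (A H : set G) : is_subgroup H -> A `<=` H -> gen A `<=` H.
Proof. by move=> Hgrp AH; exact: smallest_sub. Qed.

Lemma gen_ind (A : set G) (P : G -> Prop) :
  P 1 -> (forall x, A x -> P x) -> (forall x y, P x -> P y -> P (x * y)) ->
  (forall x, P x -> P x^-1) -> forall x, gen A x -> P x.
Proof.
move=> P1 PA PM PV; apply: gen_min PA; split=> // x y Px Py.
by apply: PM => //; exact: PV.
Qed.

(** Induction on words: it suffices that the letters and their inverses preserve
    [P], because the elements preserving [P] in this way form a subgroup. *)
Lemma gen_ind_letter (A : set G) (P : G -> Prop) :
  P 1 -> (forall a x, A a -> P x -> P (a * x)) ->
  (forall a x, A a -> P x -> P (a^-1 * x)) -> forall x, gen A x -> P x.
Proof.
move=> P1 PM PV.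
suff Hx : forall x, gen A x ->
    (forall y, P y -> P (x * y)) /\ (forall y, P y -> P (x^-1 * y)).
  by move=> x /Hx[+ _] => /(_ 1 P1); rewrite mulg1.
apply: gen_ind.
- by split=> y Py; rewrite ?invg1 mul1g.
- by move=> x Ax; split=> y; [exact: PM | exact: PV].
- move=> x y [x1 x2] [y1 y2]; split=> z Pz; rewrite ?invgM -mulgA.
    by apply/x1/y1.
  by apply/y2/x2.
- by move=> x [x1 x2]; split=> //; rewrite invgK.
Qed.

Lemma cent_subgroup (x : G) : is_subgroup [set y | commute x y].
Proof.
split=> [|y z xy xz]; first exact: commute1.
by apply: commuteM => //; exact: commuteV.
Qed.

End Generation.

(** * Locally cyclic groups *)

Lemma expgz_Zgroup (n : int) : expgz (1%R : Zgroup) n = n.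
Proof.
elim/int_rec: n => [|n IHn|n IHn] //.
- by rewrite -addn1 PoszD expgzD IHn.
- by rewrite -addn1 PoszD opprD expgzD IHn.
Qed.

Lemma hom_Zgroup (G : groupType) (f : group_hom Zgroup G) (n : int) :
  f n = expgz (f 1%R) n.
Proof. by rewrite -hom_expgz expgz_Zgroup. Qed.

Lemma contains_Z2 (G : groupType) (x y : G) : commute x y ->
  (forall i j, expgz x i * expgz y j = 1 -> i = 0%R /\ j = 0%R) ->
  contains_subgroup G (Zgroup * Zgroup)%type.
Proof.
move=> cxy indep; apply/contains_subgroupP.
pose f (u : Zgroup * Zgroup) := expgz x u.1 * expgz y u.2.
have fM : {morph f : u v / u * v}.
  move=> u v; rewrite /f /= !expgzD -!mulgA; congr (_ * _).
  rewrite !mulgA; congr (_ * _); exact: commute_expgz2.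
exists (hom_of_morph fM); apply: gmulf_inj => -[i j] /indep /= [-> ->].
by [].
Qed.

Definition trivial_action (K H : groupType) : aut_action K H :=
  @AutAction K H (fun _ => idfun) (fun _ => erefl) (fun _ _ _ => erefl).

Lemma Z2_contains_semidirect :
  contains_subgroup (Zgroup * Zgroup)%type
    (sdprod_of (trivial_action Zgroup Zgroup)).
Proof.
apply/contains_subgroupP.
pose f (u : sdprod_of (trivial_action Zgroup Zgroup)) : (Zgroup * Zgroup)%type := u.
have fM : {morph f : u v / u * v} by [].
by exists (hom_of_morph fM).
Qed.

(** A Bezout argument: torsion-freeness allows one to divide the exponents by
    their gcd, so that [u * i + v * j = 1] for some [u] and [v], and then
    [x ^ v * y ^ u] is a common root. *)
Lemma common_root (G : groupType) (x y : G) (i j : int) :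
  torsion_free G -> commute x y -> expgz x i = expgz y j ->
  i <> 0%R \/ j <> 0%R ->
  exists a b c d : int, let z := expgz x a * expgz y b in
    x = expgz z c /\ y = expgz z d.
Proof.
move=> tf cxy exy ij0.
have d0 : gcdz i j <> 0%R.
  by move/eqP; rewrite gcdz_eq0 => /andP[/eqP ? /eqP ?]; case: ij0.
have [i' Ei] := dvdzP (dvdz_gcdl i j).
have [j' Ej] := dvdzP (dvdz_gcdr i j).
have [u [v Euv]] := Bezoutz i j.
have {}Euv : (u * i' + v * j' = 1)%R.
  apply: (mulIf (introN eqP d0)); rewrite mul1r mulrDl -!mulrA -Ei -Ej //.
have exy' : expgz x i' = expgz y j'.
  have : expgz (expgz x i' * expgz y (- j')) (gcdz i j) = 1.
    rewrite expgzMn; last exact: commute_expgz2.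
    by rewrite -!expgzM mulNr -Ei -Ej exy expgzN mulgV.
  by case/(torsion_free_expgz tf) => //; rewrite expgzN => /divg1_eq.
exists v, u, j', i'; split; rewrite /= expgzMn; try exact: commute_expgz2.
  rewrite -!expgzM [(u * j')%R]mulrC (expgzM y) -exy' -expgzM -expgzD.
  by rewrite [(i' * u)%R]mulrC addrC Euv.
rewrite -!expgzM [(v * i')%R]mulrC (expgzM x) exy' -expgzM -expgzD.
by rewrite [(j' * v)%R]mulrC addrC Euv.
Qed.

Definition abelian_group (G : groupType) := forall x y : G, commute x y.

(** The generators of a finitely generated subgroup are absorbed one after the
    other into a common root. *)
Lemma locally_cyclic_dependent (H : groupType) :
  torsion_free H -> abelian_group H ->
  (forall x y : H, exists i j : int,
     (i <> 0%R \/ j <> 0%R) /\ expgz x i = expgz y j) ->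
  locally_cyclic H.
Proof.
move=> tf cH dep K Kgrp [s EK] K1.
have [z [Kz zs]] : exists z, gen [set` s] z /\
    forall x, x \in s -> range (expgz z) x.
  elim: s {K Kgrp EK K1} => [|x s [z [sz zs]]].
    by exists 1; split=> //; exact: gen1.
  have [i [j [ij0 exz]]] := dep x z.
  have /= [a [b [c [d []]]]] := common_root tf (cH x z) exz ij0.
  set w := _ * _ => Ex Ez; exists w; split.
    have gg := gen_subgroup [set` x :: s].
    apply: (subgroupM gg); apply: (subgroupXz gg).
      by apply: sub_gen; rewrite /= mem_head.
    apply: (gen_min gg _ sz) => y /= sy; apply: sub_gen.
    by rewrite /= inE sy orbT.
  move=> y; rewrite inE => /orP[/eqP ->|/zs [k _ <-]]; first by exists c.
  by exists (d * k)%R => //; rewrite expgzM -Ez.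
have ->: K = range (expgz z).
  rewrite EK; apply/seteqP; split; last first.
    by move=> _ [k _ <-]; apply: (subgroupXz (gen_subgroup _)).
  by apply: gen_min => //; apply: (is_subgroup_range (expgz_hom z)).
exists (expgz_hom z); split => //; apply: expgz_inj => // z1.
apply: K1; rewrite EK; apply/seteqP; split; last first.
  by move=> _ ->; exact: gen1.
apply: gen_min; first by split=> // x y -> ->; rewrite divgg.
by move=> x /zs [k _ <-]; rewrite z1 expgz1n.
Qed.

Lemma locally_cyclic_gen (H : groupType) (s : seq H) :
  locally_cyclic H -> exists z, gen [set` s] = range (expgz z).
Proof.
move=> lc; have [-> | s1] := pselect (gen [set` s] = [set 1]).
  exists 1; apply/seteqP; split=> [_ ->|_ [k _ <-]]; last by rewrite expgz1n.
  by exists 0%R.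
have [|f [_ fs]] := lc _ (gen_subgroup _) _ s1; first by exists s.
exists (f 1%R); rewrite -fs; apply/seteqP.
by split=> _ [k _ <-]; exists k => //; [exact/esym/hom_Zgroup | exact: hom_Zgroup].
Qed.

(** * Semidirect products with an infinite cyclic group *)

Section InternalSemidirect.
Variables (G : groupType) (H : set G) (g : G).
Hypotheses (Hgrp : is_subgroup H) (Hg : forall y, H y -> H (y ^ g))
  (HgV : forall y, H y -> H (y ^ g^-1)).

Lemma normalizing_expgz (k : int) y : H y -> H (y ^ expgz g k).
Proof.
elim/int_rec: k y => [|k IHk|k IHk] y Hy; first by rewrite conjg1.
- by rewrite -addn1 PoszD expgzD conjgM; apply/Hg/IHk.
- by rewrite -addn1 PoszD opprD expgzD conjgM; apply/HgV/IHk.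
Qed.

Local Notation S := (subgroup_type Hgrp).

Definition conj_elt (k : Zgroup) (u : S) : S :=
  subgroup_elt Hgrp (normalizing_expgz (- k)%R (subgroup_typeP u)).

Fact conj_eltM k : {morph conj_elt k : u v / u * v}.
Proof. by move=> u v; apply: subgroup_type_eq; rewrite /= conjMg. Qed.

Fact conj_elt1 u : hom_of_morph (conj_eltM 1) u = u.
Proof. by apply: subgroup_type_eq; exact: conjg1. Qed.
Fact conj_elt_comp k l u : hom_of_morph (conj_eltM (k * l)) u =
  hom_of_morph (conj_eltM k) (hom_of_morph (conj_eltM l) u).
Proof.
apply: subgroup_type_eq; rewrite /= -conjgM -expgzD; congr (_ ^ expgz _ _).
by rewrite -opprD addrC.
Qed.

Definition conj_action : aut_action Zgroup S := AutAction conj_elt1 conj_elt_comp.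

Lemma internal_semidirect : (forall k : int, H (expgz g k) -> k = 0%R) ->
  contains_subgroup G (sdprod_of conj_action).
Proof.
move=> gH; apply/contains_subgroupP.
pose f (u : sdprod_of conj_action) : G := sval u.1 * expgz g u.2.
have fM : {morph f : u v / u * v}.
  move=> u v; rewrite /f /= expgzD expgzN -!mulgA; congr (_ * _).
  by rewrite invgK mulKg.
exists (hom_of_morph fM); apply: gmulf_inj => -[u k].
rewrite hom_of_morphE /f /= => /mulg1_eq ek.
have k0 : k = 0%R.
  by apply: gH; rewrite -ek; apply: (subgroupV Hgrp); exact: subgroup_typeP.
congr pair => //; apply: subgroup_type_eq; apply: invg_inj.
by rewrite ek k0 /= invg1.
Qed.

End InternalSemidirect.

Lemma commuteP (G : groupType) (x y : G) : [~ x, y] = 1 <-> commute x y.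
Proof. by split=> [/eqP/commgP|/commgP/eqP]. Qed.

(** If [g] conjugates one non-trivial power of [x] to another, commutative
    transitivity makes [g] normalize the centralizer [C] of [x]. This [C] is
    locally cyclic because the group has no free abelian subgroup of rank 2. Since
    [C] and [g] do not span a semidirect product, a power of [g] lies in [C], so
    [g] itself commutes with [x]. *)
Lemma AH_weakly_AH (G : groupType) :
  algebraically_hyperbolic G -> weakly_algebraically_hyperbolic G.
Proof.
move=> [tf ct noHZ].
have noZ2 : ~ contains_subgroup G (Zgroup * Zgroup)%type.
  move=> Z2; apply: noHZ.
  exists Zgroup, (trivial_action Zgroup Zgroup); split.
  - by exists (1%R : int).
  - apply: locally_cyclic_dependent.
    + by move=> n k /eqP; rewrite -[_ ^+ _]/(n *+ k.+1)%R mulrn_eq0 /= => /eqP.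
    + by move=> n k; rewrite /commute -[_ * _]/(n + k)%R addrC.
    + move=> x y; have [x0|x0] := eqVneq x 0%R.
        by exists 1%R, 0%R; split; [left | rewrite x0].
      exists y, x; split; first by right; apply/eqP.
      rewrite -[x in LHS]expgz_Zgroup -[y in RHS]expgz_Zgroup -!expgzM.
      by rewrite mulrC.
  - exact: contains_subgroup_trans Z2 Z2_contains_semidirect.
split=> // x x1 m n [g eg].
have [m0|m0] := eqVneq m 0%R.
  move: eg; rewrite m0 conj1g => /esym/(torsion_free_expgz tf)[]// ->.
  by [].
have [n0|n0] := eqVneq n 0%R.
  move: eg => /eqP; rewrite n0 conjg_eq1 => /eqP/(torsion_free_expgz tf)[]//.
  by move/eqP; rewrite (negPf m0).
have ct' (a b c : G) : b <> 1 -> commute a b -> commute b c -> commute a c.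
  move=> b1 ab bc; have [->|/eqP a1] := eqVneq a 1; first exact/commute_sym/commute1.
  have [->|/eqP c1] := eqVneq c 1; first exact: commute1.
  by apply/commuteP; apply: (ct _ b) => //; apply/commuteP.
have xn1 k : (k != 0)%R -> expgz x k <> 1.
  by move=> /eqP k0 /(torsion_free_expgz tf)[].
have xg1 : x ^ g <> 1 by move/eqP; rewrite conjg_eq1 => /eqP.
have cxxg : commute x (x ^ g).
  apply: (ct' _ (expgz x n)); [exact: xn1 | exact: commute_expgz|].
  by rewrite -eg expgzJ; apply: commute_sym; exact: commute_expgz.
have Cgrp := cent_subgroup x.
have CJ (a b c : G) : commute a b -> commute (a ^ c) (b ^ c).
  by rewrite /commute -!conjMg => ->.
have Cg y : commute x y -> commute x (y ^ g).
  by move=> cxy; apply: (ct' _ (x ^ g)) => //; exact: CJ.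
have CgV y : commute x y -> commute x (y ^ g^-1).
  move=> cxy; apply: (ct' _ (x ^ g^-1)).
  - by move/eqP; rewrite conjg_eq1 => /eqP.
  - by apply: commute_sym; rewrite -[x in commute _ x](conjgK g); exact: CJ.
  - exact: CJ.
have [[k [/eqP k0 gk]]|gC] :=
    pselect (exists k : int, k <> 0%R /\ commute x (expgz g k)).
  suff cxg : commute x g.
    have : expgz x m = expgz x n.
      by rewrite -eg expgzJ; congr expgz; apply/esym/conjg_fixP/commgP.
    by move/(expgz_inj tf x1) => ->.
  have [->|/eqP g1] := eqVneq g 1; first exact: commute1.
  apply: ct' gk _; last exact/commute_sym/commute_expgz.
  by move=> /(torsion_free_expgz tf)[] // /eqP; rewrite (negPf k0).
case: noHZ; exists (subgroup_type Cgrp), (conj_action Cgrp Cg CgV); split.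
- exists (subgroup_elt Cgrp (commute_refl x)) => /(congr1 sval) /=.
  exact: x1.
- apply: locally_cyclic_dependent.
  + move=> u k /(congr1 (subgroup_incl Cgrp)); rewrite gmulfXn gmulf1 => /tf u1.
    exact: subgroup_type_eq.
  + move=> u v; apply: subgroup_type_eq => /=.
    have := subgroup_typeP u; have := subgroup_typeP v => xv xu.
    by apply: (ct' _ x) => //; exact: commute_sym.
  + move=> u v; apply: contrapT => nuv; apply: noZ2.
    apply: (@contains_Z2 _ (sval u) (sval v)).
      have := subgroup_typeP u; have := subgroup_typeP v => xv xu.
      by apply: (ct' _ x) => //; exact: commute_sym.
    move=> i j eij; apply: contrapT => ij0; apply: nuv.
    exists i, (- j)%R; split.
      apply: contrapT => /not_orP[/contrapT i0 /contrapT j0]; apply: ij0.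
      by split=> //; apply/eqP; rewrite -oppr_eq0 j0.
    apply: (@subgroup_incl_inj _ _ Cgrp); rewrite !hom_expgz expgzN.
    by apply/eqP; rewrite -mulg_eq1; apply/eqP.
- by apply: internal_semidirect => k gk; apply: contrapT => k0; apply: gC; exists k.
Qed.

(** * Baumslag-Solitar groups *)

Section PresentedHom.
Variables (X : choiceType) (R : seq (word X * word X)) (T : groupType).
Variable r : X -> T.

Definition eval_letter (l : X * bool) : T := if l.2 then (r l.1)^-1 else r l.1.
Definition eval_word (w : word X) : T := foldr (fun l y => eval_letter l * y) 1 w.

Lemma eval_word_cat u v : eval_word (u ++ v) = eval_word u * eval_word v.
Proof. by elim: u => [|l u IHu] /=; rewrite ?mul1g // IHu mulgA. Qed.

Lemma eval_gen_exp x m : eval_word (gen_exp x m) = expgz (r x) m.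
Proof.
have aux b n : eval_word (nseq n (x, b)) = eval_letter (x, b) ^+ n.
  by elim: n => // n IHn; rewrite /= IHn expgS.
by case: m => n; rewrite /gen_exp aux // /eval_letter /= expVgn.
Qed.

Hypothesis rR : forall u v, (u, v) \in R -> eval_word u = eval_word v.

Lemma eval_pres_eq u v : pres_eq R u v -> eval_word u = eval_word v.
Proof.
elim=> {u v} // [u v w _ -> _ ->|u u' v v' _ Eu _ Ev|[x []]] //.
- by rewrite !eval_word_cat Eu Ev.
- by rewrite /= /eval_letter /= mulg1 mulVg.
- by rewrite /= /eval_letter /= mulg1 mulgV.
Qed.

Definition presented_map (x : presented R) : T := eval_word (pres_word x).

Fact presented_mapE u : presented_map (pres_class R u) = eval_word u.
Proof. exact/eval_pres_eq/pres_word_class. Qed.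

Fact presented_mapM : {morph presented_map : x y / x * y}.
Proof. by move=> x y; rewrite presented_mapE eval_word_cat. Qed.

Definition presented_hom : group_hom (presented R) T := hom_of_morph presented_mapM.

End PresentedHom.

Definition pres_gen (X : choiceType) (R : seq (word X * word X)) (x : X) :
  presented R := pres_class R [:: (x, false)].

Lemma pres_class_eval (X : choiceType) (R : seq (word X * word X)) (w : word X) :
  pres_class R w = eval_word (pres_gen R) w.
Proof.
elim: w => // -[x b] w IHw.
rewrite -cat1s -[LHS]pres_mulE [RHS]/= -IHw; congr (_ * _).
case: b => //; apply: (@mulgI _ (pres_gen R x)).
rewrite mulgV [LHS]pres_mulE.
exact/pres_classP/(PresCancel R (x, false)).
Qed.

Section BaumslagSolitar.
Variables m n : int.

Definition BSa : baumslag_solitar m n := pres_gen _ false.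
Definition BSt : baumslag_solitar m n := pres_gen _ true.

Lemma BS_relation : expgz BSa m ^ BSt = expgz BSa n.
Proof.
have /pres_classP : pres_eq
    [:: (gen_exp true (-1)%R ++ gen_exp false m ++ gen_exp true 1%R, gen_exp false n)]
    (gen_exp true (-1)%R ++ gen_exp false m ++ gen_exp true 1%R) (gen_exp false n).
  by apply: PresRel; rewrite inE.
by rewrite !pres_class_eval !eval_word_cat !eval_gen_exp.
Qed.

Lemma BS_hom (G : groupType) (x t : G) : expgz x m ^ t = expgz x n ->
  exists f : group_hom (baumslag_solitar m n) G, f BSa = x /\ f BSt = t.
Proof.
move=> rel; pose r (b : bool) := if b then t else x.
have rR u v : (u, v) \in [:: (gen_exp true (-1)%R ++ gen_exp false m ++
    gen_exp true 1%R, gen_exp false n)] -> eval_word r u = eval_word r v.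
  rewrite inE => /eqP E.
  rewrite (congr1 fst E : u = _) (congr1 snd E : v = _).
  by rewrite !eval_word_cat !eval_gen_exp -rel.
exists (presented_hom rR); split; rewrite /= [LHS](presented_mapE rR);
  exact: mulg1.
Qed.

Lemma BS_ind (P : baumslag_solitar m n -> Prop) :
  P 1 -> (forall u, P u -> P (u * BSa)) -> (forall u, P u -> P (u * BSa^-1)) ->
  (forall u, P u -> P (u * BSt)) -> (forall u, P u -> P (u * BSt^-1)) ->
  forall u, P u.
Proof.
move=> P1 Pa PaV Pt PtV u; rewrite -[u]pres_wordK pres_class_eval.
elim/last_ind: (pres_word u) => // w [x b] IHw.
rewrite -cats1 eval_word_cat /= mulg1 /eval_letter /=.
by case: x; case: b; [exact: PtV | exact: Pt | exact: PaV | exact: Pa].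
Qed.

End BaumslagSolitar.

(** A group of affine maps of the rational line. For [lambda = m / n] it satisfies
    the relation of [BS(m, n)] and separates the words [a ^ k * t ^ l]. *)
Section AffineAction.
Variable lambda : rat.
Hypothesis lambda0 : lambda != 0%R.
Local Notation Qgroup := (Algebra.to_multiplicative rat).

Definition scale_by (k : Zgroup) (x : Qgroup) : Qgroup := (lambda ^ k * x)%R.
Fact scale_byM k : {morph scale_by k : x y / x * y}.
Proof. by move=> x y; exact: mulrDr. Qed.
Fact scale_by1 x : hom_of_morph (scale_byM 1) x = x.
Proof. exact: mul1r. Qed.
Fact scale_byD k l x : hom_of_morph (scale_byM (k * l)) x =
  hom_of_morph (scale_byM k) (hom_of_morph (scale_byM l) x).
Proof. by rewrite /= /scale_by mulrA -expfzDr. Qed.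

Definition affine_action : aut_action Zgroup Qgroup := AutAction scale_by1 scale_byD.

Definition affine_group : groupType := sdprod_of affine_action.
Definition translation : affine_group := (1%R : Qgroup, 1).
Definition dilation : affine_group := (1, 1%R : Zgroup).

Lemma expgz_translation (k : int) : expgz translation k = ((k%:~R)%R : Qgroup, 1).
Proof.
elim/int_rec: k => [|k IHk|k IHk] //.
  rewrite -addn1 PoszD expgzD IHk [in RHS]rmorphD /= /translation.
  by congr pair; rewrite [LHS]/= scale_by1.
rewrite -addn1 PoszD opprD expgzD IHk [in RHS]rmorphD /= /translation.
by congr pair; rewrite [LHS]/= scale_by1.
Qed.

Lemma expgz_dilation (k : int) : expgz dilation k = (1, k : Zgroup).
Proof.
elim/int_rec: k => [|k IHk|k IHk] //.
  rewrite -addn1 PoszD expgzD IHk /dilation; congr pair.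
  rewrite [LHS]mul1g; exact: mulr0.
rewrite -addn1 PoszD opprD expgzD IHk expgzN1 /dilation; congr pair.
by rewrite [LHS]mul1g [LHS]/= invg1 [X in scale_by _ X]mulr0; exact: mulr0.
Qed.

End AffineAction.

Lemma BS_independent (m n : int) (k l : int) : m <> 0%R -> n <> 0%R ->
  expgz (BSa m n) k * expgz (BSt m n) l = 1 -> k = 0%R /\ l = 0%R.
Proof.
move=> /eqP m0 /eqP n0.
have mQ : (m%:Q != 0)%R by rewrite intr_eq0.
have nQ : (n%:Q != 0)%R by rewrite intr_eq0.
have lambda0 : (m%:Q / n%:Q != 0)%R by rewrite mulf_neq0 ?invr_eq0.
have [|f [fa ft]] :=
  @BS_hom m n (affine_group lambda0) (translation lambda0) (dilation lambda0).
  rewrite !expgz_translation conjgE; apply: (@mulgI _ (dilation lambda0)).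
  rewrite mulgA mulgV mul1g.
  set r := (_ / _)%R in lambda0 *.
  have key : (m%:Q + r ^ (0 : int) * 0 = 0 + r ^ (1 : int) * n%:Q)%R.
    by rewrite expr0z expr1z mulr0 addr0 add0r divfK.
  exact: (f_equal2 pair key erefl).
move=> /(congr1 f); rewrite gmulf1 gmulfM !hom_expgz fa ft.
rewrite expgz_translation expgz_dilation => E.
have /eqP : (k%:Q + (m%:Q / n%:Q) ^ (0 : int) * 0 = 0)%R := congr1 fst E.
rewrite mulr0 addr0 intr_eq0 => /eqP ->; split=> //.
have El : (0 + l = 0)%R := congr1 snd E.
by rewrite -El add0r.
Qed.

(** In a Baumslag-Solitar subgroup the powers [a ^ m] and [a ^ n] are conjugate,
    hence [n] is [m] or [- m]. Then [a ^ m] commutes with [t ^ 2], and the two span a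
    free abelian group of rank 2. *)
Lemma weakly_AH_BS_free (G : groupType) :
  weakly_algebraically_hyperbolic G -> BS_free G.
Proof.
move=> [noZ2 conjP] [m [n [m0 n0 /contains_subgroupP[f f_inj]]]].
pose x := f (BSa m n); pose t := f (BSt m n).
have rel : expgz x m ^ t = expgz x n.
  by rewrite -!hom_expgz -gmulfJ BS_relation.
have indep k l : expgz x k * expgz t l = 1 -> k = 0%R /\ l = 0%R.
  rewrite -!hom_expgz -gmulfM => E.
  have f1 : f 1 = 1 by exact: gmulf1.
  move: E; rewrite -[RHS]f1 => /f_inj; exact: BS_independent.
have x1 : x <> 1.
  by move=> x1; case: (indep 1%R 0%R); rewrite ?expgz1 ?x1 ?mulg1.
have /eqP := conjP x x1 m n (ex_intro _ t rel).
rewrite eqr_norm2 => mn.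
apply: noZ2; apply: (@contains_Z2 _ (expgz x m) (expgz t 2)).
  apply/commgP; rewrite -conjg_fix; apply/eqP.
  rewrite [expgz t 2]expg2 conjgM rel.
  have {mn} [E|E] : n = m \/ n = (- m)%R.
    case/orP: mn => /eqP ->; [by left | by right; rewrite opprK].
  - by rewrite E expgzJ -expgzJ rel E.
  - by rewrite E expgzN conjVg rel E expgzN invgK.
move=> i j; rewrite -!expgzM => /indep[/eqP + /eqP].
by rewrite !mulf_eq0 (introF eqP m0) /= => /eqP -> /eqP ->.
Qed.

(** The relation [a * t = t * a ^ n] moves positive powers of [t] to the left, and
    negative powers to the right, of the powers of [a]. *)
Lemma BS1_normal_form (n : int) (u : baumslag_solitar 1 n) :
  exists (i j : nat) (k : int),
    u = BSt 1 n ^+ i * expgz (BSa 1 n) k * BSt 1 n ^- j.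
Proof.
set a := BSa 1 n; set t := BSt 1 n.
have at_ k : expgz a k * t = t * expgz a (n * k)%R.
  by rewrite conjgC expgzJ [a ^ t](BS_relation 1 n) -expgzM.
have taV k (j : nat) : exists l : int, t ^- j * expgz a k = expgz a l * t ^- j.
  elim: j k => [|j IHj] k; first by exists k; rewrite invg1 mul1g mulg1.
  have [l El] := IHj k; exists (n * l)%R; rewrite expgSr invgM -mulgA El.
  apply: (@mulgI _ t); rewrite mulVKg [RHS]mulgA -at_.
  by rewrite -!mulgA mulVKg.
elim/BS_ind: u => [|u|u|u|u].
- by exists 0%N, 0%N, 0%R; rewrite invg1 !mulg1.
- move=> [i [j [k ->]]]; have [l El] := taV 1%R j.
  exists i, j, (k + l)%R; rewrite expgzD -!mulgA; congr (_ * (_ * _)).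
  exact: El.
- move=> [i [j [k ->]]]; have [l El] := taV (-1)%R j.
  exists i, j, (k + l)%R; rewrite expgzD -!mulgA; congr (_ * (_ * _)).
  exact: El.
- move=> [i [[|j] [k ->]]]; last first.
    by exists i, j, k; rewrite expgS invgM -mulgA mulgVK.
  exists i.+1, 0%N, (n * k)%R; rewrite invg1 !mulg1 -mulgA at_ mulgA.
  by rewrite -expgSr.
- move=> [i [j [k ->]]]; exists i, j.+1, k.
  by rewrite expgS invgM mulgA.
Qed.

(** The map from [BS(1, n)] is injective because the hypotheses leave only the
    trivial normal form above [1]. *)
Lemma contains_BS1 (G : groupType) (x t : G) (n : int) :
  torsion_free G -> x <> 1 -> n <> 0%R -> x ^ t = expgz x n ->
  (forall i j : int, expgz t i = expgz x j -> i = 0%R) -> ~ BS_free G.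
Proof.
move=> tf x1 n0 rel indep; apply; exists 1%R, n; split=> //.
apply/contains_subgroupP; have [f [fa ft]] := @BS_hom 1 n G x t rel.
exists f; apply: gmulf_inj => u; have [i [j [k ->]]] := BS1_normal_form u.
rewrite !gmulfM gmulfV !gmulfXn hom_expgz fa ft => E.
have Ek : expgz x k = t ^- i * t ^+ j.
  by rewrite -(divg1_eq E) mulKg.
have Eij : (j%:Z - i%:Z = 0)%R.
  apply: (indep _ k); rewrite Ek addrC expgzD expgzN //.
have {}Eij : i = j by move/eqP: Eij; rewrite subr_eq0 => /eqP[].
have k0 : k = 0%R.
  by move: Ek; rewrite Eij mulVg => /(torsion_free_expgz tf)[].
by rewrite Eij k0 mulg1 mulgV.
Qed.

Local Open Scope ring_scope.

(** * Free abelian groups *)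

Section Additive.
Variables (M N : zmodType) (f : M -> N).
Hypothesis fD : {morph f : x y / x + y}.

Lemma additive_morphB : zmod_morphism f.
Proof.
by move=> x y; apply: (addIr (f y)); rewrite -fD !subrK.
Qed.
Let fun_of_additive of {morph f : x y / x + y} := f.
HB.instance Definition _ :=
  GRing.isZmodMorphism.Build M N (fun_of_additive fD) additive_morphB.
Definition additive_of_morph : {additive M -> N} := fun_of_additive fD.
End Additive.

Section FreeAbelian.
Variable Y : choiceType.
Local Notation F := {freeg Y / int}.

Definition delta (y : Y) : F := << y >>.

Section Lift.
Variables (M : zmodType) (f : Y -> M).
Let liftZ : F -> M := fglift (f : Y -> zmodule M).
Fact freeg_liftD : {morph liftZ : u v / u + v}.
Proof.
have fB : zmod_morphism liftZ := lift_is_additive (f : Y -> zmodule M).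
move=> u v; rewrite -{1}[v]opprK fB -[- v]add0r fB -{1}(subrr v) fB.
by rewrite subrr add0r opprK.
Qed.
Definition freeg_lift : {additive F -> M} := locked (additive_of_morph freeg_liftD).
Lemma freeg_lift_delta y : freeg_lift (delta y) = f y.
Proof. by rewrite /freeg_lift -lock /= /liftZ liftU. Qed.
End Lift.

Lemma freeg_ind (P : F -> Prop) : (forall y, P (delta y)) -> P 0 ->
  (forall u v, P u -> P v -> P (u + v)) -> (forall u, P u -> P (- u)) ->
  forall u, P u.
Proof.
move=> Py P0 PD PN u; rewrite -[u]freeg_sumE.
elim/big_ind: _ => // y _.
have Pn (n : nat) : P << n%:Z *g y >>.
  elim: n => [|n IHn]; first by rewrite freegU0.
  by rewrite -addn1 PoszD -freegUD; apply: PD => //; exact: Py.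
by case: (coeff y u) => n; rewrite ?NegzE -?freegUN //; apply: PN.
Qed.

Lemma freeg_additive_eq (M : zmodType) (f g : {additive F -> M}) :
  (forall y, f (delta y) = g (delta y)) -> f =1 g.
Proof.
move=> fg; elim/freeg_ind => [//||u v Eu Ev|u Eu].
- by rewrite !raddf0.
- by rewrite !raddfD Eu Ev.
- by rewrite !raddfN Eu.
Qed.

Lemma freegP (u v : F) : (forall y, coeff y u = coeff y v) -> u = v.
Proof. by move=> uv; apply/eqP/freeg_eqP. Qed.

Lemma coeff_delta x y : coeff x (delta y) = (y == x)%:R.
Proof. by rewrite /delta coeffU mul1r. Qed.

Lemma freeg_of_fun (f : Y -> int) (s : seq Y) : (forall y, f y != 0 -> y \in s) ->
  exists u : F, forall y, coeff y u = f y.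
Proof.
move=> fs; exists (\sum_(y <- undup s) << f y *g y >>) => x.
rewrite raddf_sum /=; have [sx|sx] := boolP (x \in undup s).
  rewrite (bigD1_seq x) ?undup_uniq //= coeffU eqxx mulr1 big1 ?addr0 // => y yx.
  by rewrite coeffU (negPf yx) mulr0.
rewrite big_seq big1 => [|y sy]; last first.
  by rewrite coeffU (negPf (memPn sx _ sy)) mulr0.
by apply/esym/eqP; apply: contraNT sx => /fs; rewrite mem_undup.
Qed.

End FreeAbelian.

Definition freeg_map (Y Z : choiceType) (f : Y -> Z) :
  {additive {freeg Y / int} -> {freeg Z / int}} :=
  freeg_lift (fun y => delta (f y)).

Arguments freeg_map : simpl never.

Lemma freeg_map_delta (Y Z : choiceType) (f : Y -> Z) y :
  freeg_map f (delta y) = delta (f y).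
Proof. exact: freeg_lift_delta. Qed.

Lemma coeff_freeg_map (Y Z : choiceType) (f : Y -> Z) (fI : injective f) y u :
  coeff (f y) (freeg_map f u) = coeff y u.
Proof.
elim/freeg_ind: u => [x||u v Eu Ev|u Eu].
- by rewrite freeg_map_delta !coeff_delta (inj_eq fI).
- by rewrite raddf0 !coeff0.
- by rewrite raddfD !coeffD Eu Ev.
- by rewrite raddfN !coeffN Eu.
Qed.

(** * Modules over a group *)

Section Modules.
Variable G : groupType.
Implicit Types M N P : gmodule G.

Section MakeHom.
Variables (M N : gmodule G) (f : M -> N).
Hypotheses (fD : {morph f : x y / x + y})
  (fJ : forall g v, f (gmod_act M g v) = gmod_act N g (f v)).
Definition mk_gmod_hom : gmod_hom M N :=
  @GModHom G M N (additive_of_morph fD) fJ.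
End MakeHom.

(** Diagram chases define homomorphisms as relations; by linearity a relation is
    single-valued as soon as it is so at [0]. *)
Lemma gmod_hom_of_rel M N (R : M -> N -> Prop) :
  (forall x, exists y, R x y) -> (forall y, R 0 y -> y = 0) ->
  (forall x x' y y', R x y -> R x' y' -> R (x + x') (y + y')) ->
  (forall x y, R x y -> R (- x) (- y)) ->
  (forall g x y, R x y -> R (gmod_act M g x) (gmod_act N g y)) ->
  exists f : gmod_hom M N, forall x y, R x y <-> f x = y.
Proof.
move=> Rtot R0 RD RN RJ.
have Rfun x y y' : R x y -> R x y' -> y = y'.
  move=> xy xy'; apply/eqP; rewrite -subr_eq0; apply/eqP/R0.
  by rewrite -(subrr x); apply: RD => //; exact: RN.
pose f x := sval (cid (Rtot x)).
have fR x : R x (f x) by rewrite /f; case: cid.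
have fD : {morph f : x y / x + y}.
  by move=> x y; apply: Rfun (fR _) _; exact: RD.
have fJ g x : f (gmod_act M g x) = gmod_act N g (f x).
  by apply: Rfun (fR _) _; exact: RJ.
exists (mk_gmod_hom fD fJ) => x y /=; split=> [xy|<-//].
exact: Rfun (fR _) xy.
Qed.

Definition gmod_comp M N P (g : gmod_hom N P) (f : gmod_hom M N) : gmod_hom M P.
Proof.
refine (@mk_gmod_hom M P (fun v => g (f v)) _ _).
  by move=> x y; rewrite !raddfD.
by move=> h v; rewrite !gmod_homJ.
Defined.

Definition gmod_id M : gmod_hom M M :=
  @mk_gmod_hom M M id (fun _ _ => erefl) (fun _ _ => erefl).

Definition gmod_sub M N (f g : gmod_hom M N) : gmod_hom M N.
Proof.
refine (@mk_gmod_hom M N (fun v => f v - g v) _ _).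
  by move=> x y; rewrite !raddfD addrACA.
by move=> h v; rewrite !gmod_homJ raddfB.
Defined.

(** The action of the element [h - 1] of the group ring. *)
Definition gmod_diff M (h : G) (v : M) : M := gmod_act M h v - v.

Lemma gmod_diffD M h : {morph @gmod_diff M h : u v / u + v}.
Proof. by move=> u v; rewrite /gmod_diff raddfD opprD addrACA. Qed.
Lemma gmod_diff0 M h : gmod_diff h (0 : M) = 0.
Proof. by rewrite /gmod_diff raddf0 subrr. Qed.
Lemma gmod_diffN M h (v : M) : gmod_diff h (- v) = - gmod_diff h v.
Proof. by rewrite /gmod_diff raddfN opprD. Qed.
Lemma gmod_diffB M h (u v : M) : gmod_diff h (u - v) = gmod_diff h u - gmod_diff h v.
Proof. by rewrite gmod_diffD gmod_diffN. Qed.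
Lemma gmod_diff_hom M N (f : gmod_hom M N) h v : f (gmod_diff h v) = gmod_diff h (f v).
Proof. by rewrite /gmod_diff raddfB gmod_homJ. Qed.
Lemma gmod_diff_act M g h (v : M) : commute g h ->
  gmod_act M g (gmod_diff h v) = gmod_diff h (gmod_act M g v).
Proof. by move=> cgh; rewrite /gmod_diff raddfB -!gmod_actM cgh. Qed.
Lemma gmod_diffC M g h (v : M) : commute g h ->
  gmod_diff g (gmod_diff h v) = gmod_diff h (gmod_diff g v).
Proof. by move=> cgh; rewrite {1}/gmod_diff gmod_diff_act // -gmod_diffB. Qed.

(** In the group ring, [h - 1] divides [h ^ n - 1] for every integer [n]. *)
Lemma gmod_diff_expgz M h (n : int) (u : M) :
  exists w, gmod_act M (expgz h n) u - u = gmod_diff h w.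
Proof.
elim/int_rec: n => [|n [w Ew]|n [w Ew]].
- by exists 0; rewrite gmod_act1 subrr gmod_diff0.
- exists (w + gmod_act M (expgz h n) u); rewrite gmod_diffD -Ew.
  have -> : expgz h n.+1 = (h * expgz h n)%g by exact: expgS.
  by rewrite gmod_actM /gmod_diff [RHS]addrC subrKA.
- exists (w - gmod_act M (expgz h (- n.+1%:Z)) u); rewrite gmod_diffB -Ew.
  rewrite /gmod_diff -gmod_actM -[h in (h * _)%g]expgz1 -expgzD.
  have -> : (1 - n.+1%:Z = - n%:Z)%R by lia.
  by rewrite opprB [RHS]addrC subrKA.
Qed.

(** * Free modules *)

Section Free.
Variable X : choiceType.

Definition free_act (g : G) :
  {additive {freeg (X * G)%type / int} -> {freeg (X * G)%type / int}} :=
  freeg_map (fun u : X * G => (u.1, g * u.2)%g).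

Fact free_act1 v : free_act 1 v = v.
Proof.
have : free_act 1 =1 @idfun {freeg (X * G)%type / int}.
  apply: freeg_additive_eq => -[x k]; rewrite freeg_map_delta /=.
  by rewrite mul1g.
by apply.
Qed.

Fact free_actM g h v : free_act (g * h) v = free_act g (free_act h v).
Proof.
have : free_act (g * h) =1 free_act g \o free_act h.
  apply: freeg_additive_eq => -[x k]; rewrite /= !freeg_map_delta /=.
  by rewrite mulgA.
by apply.
Qed.

Definition free_gmod : gmodule G := GModule free_act1 free_actM.

Lemma free_gmod_delta g x k :
  gmod_act free_gmod g (delta (x, k)) = delta (x, (g * k)%g).
Proof. exact: freeg_map_delta. Qed.

Lemma coeff_free_act g x k (v : free_gmod) :
  coeff (x, (g * k)%g) (gmod_act free_gmod g v) = coeff (x, k) v.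
Proof.
apply: (@coeff_freeg_map _ _ (fun u : X * G => (u.1, g * u.2)%g) _ (x, k)).
by move=> [y l] [y' l'] /= [-> /mulgI ->].
Qed.

Lemma coeff_free_actV g x k (v : free_gmod) :
  coeff (x, k) (gmod_act free_gmod g v) = coeff (x, (g^-1 * k)%g) v.
Proof. by rewrite -[in RHS](coeff_free_act g) mulVKg. Qed.

Lemma free_gmod_deltaE x k :
  (delta (x, k) : free_gmod) = gmod_act free_gmod k (delta (x, 1%g)).
Proof. by rewrite free_gmod_delta mulg1. Qed.

Section FreeLift.
Variables (M : gmodule G) (m : X -> M).
Let lft : {additive free_gmod -> M} :=
  freeg_lift (fun u : X * G => gmod_act M u.2 (m u.1)).
Fact free_liftJ g v : lft (gmod_act free_gmod g v) = gmod_act M g (lft v).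
Proof.
have : lft \o gmod_act free_gmod g =1 gmod_act M g \o lft.
  apply: freeg_additive_eq => -[x k]; rewrite /= free_gmod_delta.
  by rewrite !freeg_lift_delta gmod_actM.
by apply.
Qed.
Definition free_lift : gmod_hom free_gmod M := GModHom free_liftJ.
Lemma free_lift_delta x k : free_lift (delta (x, k)) = gmod_act M k (m x).
Proof. exact: freeg_lift_delta. Qed.
End FreeLift.

Lemma free_hom_eq M (f g : gmod_hom free_gmod M) :
  (forall x, f (delta (x, 1%g)) = g (delta (x, 1%g))) -> f =1 g.
Proof.
move=> fg; apply: freeg_additive_eq => -[x k].
by rewrite free_gmod_deltaE !gmod_homJ fg.
Qed.

End Free.

(** Projectivity in the form used below: an embedding into a free module gives
    coefficients to compute with, and this form survives restriction to a
    subgroup. *)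
Definition retract_of_free P : Prop :=
  exists (X : choiceType) (i : gmod_hom P (free_gmod X)) (r : gmod_hom (free_gmod X) P),
    cancel i r.

Lemma free_retract X : retract_of_free (free_gmod X).
Proof. by exists X, (gmod_id _), (gmod_id _). Qed.

(** The free module on the set underlying [P] maps onto [P]. *)
Lemma projective_retract P : projective P -> retract_of_free P.
Proof.
move=> Pproj; exists P.
pose r := free_lift (id : P -> P).
have [|i iK] := Pproj _ _ r (gmod_id P); last by exists i, r.
move=> v; exists (delta (v, 1%g)).
by rewrite free_lift_delta gmod_act1.
Qed.

(** The lift is chosen on the basis of a free module that has [P] as a retract. *)
Lemma retract_lift P M N (p : gmod_hom M N) (f : gmod_hom P N) :
  retract_of_free P -> (forall v, exists m, p m = f v) ->
  exists h : gmod_hom P M, forall v, p (h v) = f v.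
Proof.
move=> [X [i [r iK]]] pf.
pose m (x : X) := sval (cid (pf (r (delta (x, 1%g))))).
have pm x : p (m x) = f (r (delta (x, 1%g))) by rewrite /m; case: cid.
pose h := free_lift m.
have ph : gmod_comp p h =1 gmod_comp f r.
  apply: free_hom_eq => x; rewrite [LHS]/= freeg_lift_delta.
  by rewrite gmod_act1 pm.
exists (gmod_comp h i) => v; have /= -> := ph (i v).
by rewrite iK.
Qed.

End Modules.

(** * Restriction to a subgroup *)

Lemma coset_representatives (G : groupType) (H : set G) : is_subgroup H ->
  exists rep : G -> G, (forall g, H (g / rep g)%g) /\
    (forall h g, H h -> rep (h * g)%g = rep g).
Proof.
move=> Hgrp; pose C g : pred G := fun g' => `[< H (g / g')%g >].
have Cg g : C g g by apply/asboolP; rewrite divgg; exact: subgroup1.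
exists (fun g => choose (C g) g); split=> [g|h g Hh].
  by apply/asboolP; exact: (chooseP (Cg g)).
have Chg : C (h * g)%g =1 C g.
  move=> g'; apply: asbool_equiv_eq; rewrite -mulgA; split=> Hx.
    by rewrite -(mulKg h (g / g')%g); apply: subgroupM => //; exact: subgroupV.
  exact: subgroupM.
rewrite (eq_choose Chg); apply: choose_id => //.
by rewrite -Chg; exact: Cg.
Qed.

Section Restriction.
Variables (K G : groupType) (f : group_hom K G).

Definition res_gmod (M : gmodule G) : gmodule K.
Proof.
refine (@GModule K M (fun k => gmod_act M (f k)) _ _).
  by move=> v; rewrite gmulf1 gmod_act1.
by move=> g h v; rewrite gmulfM gmod_actM.
Defined.

Definition res_hom (M N : gmodule G) (p : gmod_hom M N) :
  gmod_hom (res_gmod M) (res_gmod N) :=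
  @GModHom K (res_gmod M) (res_gmod N) p (fun k v => gmod_homJ p (f k) v).

Hypothesis f_inj : injective f.

(** A free module on [X] restricts to the free module on the product of [X] with
    a set of representatives of the cosets of [K]. *)
Lemma res_free (X : choiceType) : retract_of_free (res_gmod (free_gmod G X)).
Proof.
have [rep [repP repM]] := coset_representatives (is_subgroup_range f).
pose q g := sval (cid2 (repP g)).
have qP g : f (q g) = (g / rep g)%g by rewrite /q; case: cid2.
pose F := res_gmod (free_gmod G X).
pose i : {additive F -> free_gmod K (X * G)%type} :=
  freeg_lift (fun u : X * G => delta ((u.1, rep u.2), q u.2)).
have iE u : i (delta u) = delta ((u.1, rep u.2), q u.2).
  exact: freeg_lift_delta.
have iJ k v : i (gmod_act F k v) = gmod_act (free_gmod K (X * G)%type) k (i v).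
  have : i \o gmod_act F k =1 gmod_act (free_gmod K (X * G)%type) k \o i.
    apply: freeg_additive_eq => -[x g] /=.
    rewrite (_ : free_act X (f k) _ = delta (x, (f k * g)%g));
      last exact: freeg_map_delta.
    rewrite !iE [RHS]freeg_map_delta /= repM; last by exists k.
    congr (delta (_, _)); apply: f_inj; rewrite gmulfM !qP repM ?mulgA //.
  by apply.
pose r := @free_lift K (X * G)%type F (fun u => delta u).
exists (X * G)%type, (@GModHom K F _ i iJ), r.
apply: (freeg_additive_eq (f := r \o i) (g := idfun)) => -[x g] /=.
by rewrite iE [LHS]freeg_lift_delta [LHS]freeg_map_delta /= qP mulgVK.
Qed.

Lemma res_retract (P : gmodule G) :
  retract_of_free P -> retract_of_free (res_gmod P).
Proof.
move=> [X [i [r iK]]]; have [X' [i' [r' i'K]]] := res_free X.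
exists X', (gmod_comp i' (res_hom i)), (gmod_comp (res_hom r) r') => v.
by rewrite /= i'K iK.
Qed.

End Restriction.

(** * Resolutions of length two *)

(** A projective resolution of the trivial module by three modules. Its augmentation
    is kept as an invariant additive map, so that it restricts to subgroups without
    any change of the trivial module. *)
Record resolution2 (G : groupType) := Resolution2 {
  res0 : gmodule G; res1 : gmodule G; res2 : gmodule G;
  res_d1 : gmod_hom res1 res0; res_d2 : gmod_hom res2 res1;
  res_eps : {additive res0 -> int};
  res_epsJ : forall g v, res_eps (gmod_act res0 g v) = res_eps v;
  res_eps_surj : exists v, res_eps v = 1;
  res_ker_eps : forall v, res_eps v = 0 <-> exists w, res_d1 w = v;
  res_ker_d1 : forall v, res_d1 v = 0 <-> exists w, res_d2 w = v;
  res_d2_inj : injective res_d2;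
  res0_retract : retract_of_free res0;
  res1_retract : retract_of_free res1;
  res2_retract : retract_of_free res2
}.

Lemma cd_le2_resolution (G : groupType) : cd_le G 2 -> exists R : resolution2 G, True.
Proof.
move=> [P [d [eps [Pproj eps_surj ker_eps ker_d P0]]]].
unshelve eexists (@Resolution2 G (P 0%N) (P 1%N) (P 2%N) (d 0%N) (d 1%N) eps
  _ _ _ _ _ _ _ _); rewrite //=; try exact/projective_retract.
- by move=> g v; rewrite gmod_homJ.
- exact: ker_d.
- apply: raddf_inj => v /ker_d[w <-]; rewrite (P0 3%N _ w) //.
  exact: raddf0.
Qed.

Lemma restrict_resolution (K G : groupType) (f : group_hom K G) :
  injective f -> (exists R : resolution2 G, True) -> exists R : resolution2 K, True.
Proof.
move=> f_inj [[P0 P1 P2 d1 d2 eps epsJ eps1 ker_eps ker_d1 d2_inj r0 r1 r2] _].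
unshelve eexists (@Resolution2 K (res_gmod f P0) (res_gmod f P1) (res_gmod f P2)
  (res_hom f d1) (res_hom f d2) eps _ _ _ _ _ _ _ _) => //;
  try exact: res_retract.
by move=> k v; exact: epsJ.
Qed.

(** * Torsion-freeness *)

Section Torsion.
Variables (G : groupType) (x : G) (m : nat).
Hypotheses (m_gt0 : (0 < m)%N) (xm : (x ^+ m = 1)%g)
  (m_min : forall k, (0 < k)%N -> (x ^+ k = 1)%g -> (m <= k)%N).

Definition gmod_norm (M : gmodule G) (v : M) : M :=
  \sum_(i < m) gmod_act M (x ^+ i)%g v.

Lemma gmod_normB (M : gmodule G) (u v : M) :
  gmod_norm (u - v) = gmod_norm u - gmod_norm v.
Proof. by rewrite /gmod_norm -sumrB; apply: eq_bigr => i _; rewrite raddfB. Qed.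

Lemma gmod_norm_hom (M N : gmodule G) (f : gmod_hom M N) v :
  f (gmod_norm v) = gmod_norm (f v).
Proof. by rewrite raddf_sum; apply: eq_bigr => i _; rewrite gmod_homJ. Qed.

Lemma gmod_norm_act (M : gmodule G) (v : M) : gmod_norm (gmod_act M x v) = gmod_norm v.
Proof.
rewrite /gmod_norm; case: m m_gt0 xm => // n _ xn.
rewrite big_ord_recr [RHS]big_ord_recl /=.
rewrite addrC -gmod_actM -expgSr xn !gmod_act1; congr (_ + _).
by apply: eq_bigr => i _; rewrite -gmod_actM -expgSr.
Qed.

Lemma gmod_diff_norm (M : gmodule G) (v : M) : gmod_diff x (gmod_norm v) = 0.
Proof.
have -> : gmod_diff x (gmod_norm v) = gmod_norm (gmod_diff x v).
  rewrite /gmod_diff gmod_normB raddf_sum; congr (_ - _).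
  by apply: eq_bigr => i _; rewrite -!gmod_actM -expgS -expgSr.
by rewrite gmod_normB gmod_norm_act subrr.
Qed.

Lemma gmod_norm_diff (M : gmodule G) (v : M) : gmod_norm (gmod_diff x v) = 0.
Proof. by rewrite gmod_normB gmod_norm_act subrr. Qed.

Let H : set G := [set (x ^+ k)%g | k in [set: nat]].

Lemma powers_subgroup : is_subgroup H.
Proof.
split=> [|_ _ [k _ <-] [l _ <-]]; first by exists 0%N.
exists (k + (m - 1) * l)%N => //.
rewrite expgnDr; congr (_ * _)%g; apply/esym/mulg1_eq.
by rewrite -expgnDr -{1}[l]mul1n -mulnDl subnKC // expgnA xm expg1n.
Qed.

Lemma powers_inj (i j : 'I_m) : (x ^+ i = x ^+ j)%g -> i = j.
Proof.
wlog le_ij : i j / (i <= j)%N => [wl E|E].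
  by case/orP: (leq_total i j) => ?; [|apply/esym]; exact: wl.
apply/val_inj/eqP; rewrite eqn_leq le_ij -subn_eq0 -leqn0 leqNgt /=.
apply/negP => /m_min; rewrite expgnFr // E mulgV => /(_ erefl).
by rewrite leqNgt ltn_subLR ?(leq_trans (ltn_ord j)) ?leq_addl //.
Qed.

(** On a free module the group generated by [x] acts freely on the basis, so both
    statements can be read off on representatives of its orbits. *)
Section FreeTate.
Variable X : choiceType.
Local Notation F := (free_gmod G X).

Lemma coeff_norm s g (v : F) :
  coeff (s, g) (gmod_norm v) = \sum_(i < m) coeff (s, (x ^- i * g)%g) v.
Proof.
rewrite raddf_sum; apply: eq_bigr => i _ /=.
by rewrite -[in RHS](coeff_free_act (x ^+ i)%g) mulVKg.
Qed.

Lemma orbit_representatives : exists rep : G -> G,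
  (forall g, exists k, g = (x ^+ k * rep g)%g) /\
  (forall g, rep (rep g) = rep g) /\
  (forall g (c : G -> int), (forall h, rep h != h -> c h = 0) ->
     \sum_(i < m) c (x ^- i * g)%g = c (rep g)).
Proof.
have [rep [repP repM]] := coset_representatives powers_subgroup.
have rep_rep g : rep (rep g) = rep g.
  by rewrite -[in RHS](mulgVK (rep g) g) repM.
exists rep; split.
  by move=> g; have [k _ Ek] := repP g; exists k; rewrite Ek mulgVK.
split=> // g c c0; have [k _ Ek] := repP g.
pose i0 := Ordinal (ltn_pmod k m_gt0).
have Ei0 : (x ^+ i0 = g / rep g)%g.
  by rewrite -Ek [in RHS](divn_eq k m) expgnDr mulnC expgnA xm expg1n mul1g.
rewrite (bigD1 i0) //= big1 ?addr0 => [|i ii0].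
  by rewrite -[X in (X^-1)%g]/((x ^+ i0)%g) Ei0 invgF mulgVK.
apply: c0; apply: contra ii0 => /eqP E; apply/eqP/powers_inj.
rewrite Ei0; apply: (@mulIg _ (rep g)); rewrite mulgVK.
rewrite (_ : rep g = (x ^- i * g)%g) ?mulVKg // -E repM //.
by apply: (subgroupV powers_subgroup); exists i.
Qed.

Lemma free_invariant_norm (v : F) : gmod_diff x v = 0 -> exists w, v = gmod_norm w.
Proof.
move=> /eqP; rewrite subr_eq0 => /eqP vx.
have vxk k : gmod_act F (x ^+ k)%g v = v.
  by elim: k => [|k IHk]; rewrite ?gmod_act1 // expgS gmod_actM IHk.
have [rep [_ [rep_rep repS]]] := orbit_representatives.
pose c (u : X * G) : int := if rep u.2 == u.2 then coeff u v else 0.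
have [|w Ew] := @freeg_of_fun _ c (dom v).
  move=> u; rewrite /c; case: ifP => // _; by rewrite mem_dom.
exists w; apply: freegP => -[s g]; rewrite coeff_norm.
under eq_bigr do rewrite Ew.
rewrite (repS g (fun h => c (s, h))) => [|h /negPf hh]; last by rewrite /c /= hh.
rewrite /c /= rep_rep eqxx.
have := repS g (fun h => (h == rep g)%:R * coeff (s, h) v).
rewrite eqxx mul1r => <- => [|h]; last first.
  have [->|_ _] := eqVneq h (rep g); last by rewrite mul0r.
  by rewrite rep_rep eqxx.
have vi (i : 'I_m) : coeff (s, (x ^- i * g)%g) v = coeff (s, g) v.
  by rewrite -[in LHS](coeff_free_act (x ^+ i)%g) mulVKg vxk.
under eq_bigr do rewrite vi.
have := repS g (fun h => (h == rep g)%:R).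
rewrite -mulr_suml eqxx => -> => [|h]; first by rewrite mul1r.
by have [->|//] := eqVneq h (rep g); rewrite rep_rep eqxx.
Qed.

Lemma free_norm0_diff (v : F) : gmod_norm v = 0 -> exists w, v = gmod_diff x w.
Proof.
have [rep [repP [rep_rep repS]]] := orbit_representatives => Nv.
pose T : {additive F -> F} := freeg_map (fun u : X * G => (u.1, rep u.2)).
have TE u : T (delta u) = delta (u.1, rep u.2) by exact: freeg_map_delta.
have Tdiff u : exists w, u - T u = gmod_diff x w.
  elim/freeg_ind: u => [[s g]||u v' [w Ew] [w' Ew']|u [w Ew]].
  - have [k Ek] := repP g; have [w Ew] := gmod_diff_expgz x k%:Z (delta (s, rep g) : F).
    by exists w; rewrite -Ew TE free_gmod_delta -Ek.
  - by exists 0; rewrite raddf0 subrr gmod_diff0.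
  - by exists (w + w'); rewrite gmod_diffD -Ew -Ew' raddfD opprD addrACA.
  - by exists (- w); rewrite gmod_diffN -Ew raddfN opprD.
have [w Ew] := Tdiff v.
suff Tv0 : T v = 0 by exists w; rewrite -Ew Tv0 subr0.
have NT : gmod_norm (T v) = 0.
  by rewrite -[T v](subKr v) Ew gmod_normB Nv gmod_norm_diff subrr.
have T0 s h u : rep h != h -> coeff (s, h) (T u) = 0.
  move=> hh; elim/freeg_ind: u => [[s' g]||u v' Eu Ev|u Eu].
  - rewrite TE coeff_delta; case: eqP => // -[_ E].
    by rewrite -E rep_rep eqxx in hh.
  - by rewrite raddf0 coeff0.
  - by rewrite raddfD coeffD Eu Ev.
  - by rewrite raddfN coeffN Eu.
apply: freegP => -[s g]; rewrite coeff0.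
have [gg|] := eqVneq (rep g) g; last exact: T0.
rewrite -gg -(repS g (fun h => coeff (s, h) (T v))) => [|h]; last exact: T0.
by rewrite -coeff_norm NT coeff0.
Qed.

End FreeTate.

Section RetractTate.
Variable P : gmodule G.
Hypothesis Pfree : retract_of_free P.

Lemma invariant_norm (v : P) : gmod_diff x v = 0 -> exists w, v = gmod_norm w.
Proof.
have [X [i [r iK]]] := Pfree => xv.
have [|w Ew] := @free_invariant_norm X (i v).
  by rewrite -gmod_diff_hom xv raddf0.
by exists (r w); rewrite -gmod_norm_hom -Ew iK.
Qed.

Lemma norm0_diff (v : P) : gmod_norm v = 0 -> exists w, v = gmod_diff x w.
Proof.
have [X [i [r iK]]] := Pfree => Nv.
have [|w Ew] := @free_norm0_diff X (i v).
  by rewrite -gmod_norm_hom Nv raddf0.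
by exists (r w); rewrite -gmod_diff_hom -Ew iK.
Qed.

End RetractTate.

(** Dimension shifting in Tate cohomology of the cyclic group generated by [x]:
    the invariant [1] of the trivial module must be a norm up to the boundaries of a
    projective resolution of length 2, so that [1] is a multiple of [m]. *)
Lemma resolution_order1 : resolution2 G -> m = 1%N.
Proof.
move=> [P0 P1 P2 d1 d2 eps epsJ [p0 Ep0] ker_eps ker_d1 d2_inj r0 r1 r2].
have [|y Ey] := (ker_eps (gmod_diff x p0)).1.
  by rewrite /gmod_diff raddfB epsJ subrr.
have [|z Ez] := (ker_d1 (gmod_norm y)).1.
  by rewrite gmod_norm_hom Ey gmod_norm_diff.
have [|w Ew] := invariant_norm r2 (v := z).
  by apply: d2_inj; rewrite gmod_diff_hom Ez gmod_diff_norm raddf0.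
have [|v Ev] := norm0_diff r1 (v := y - d2 w).
  by rewrite gmod_normB -gmod_norm_hom -Ew Ez subrr.
have [|u Eu] := invariant_norm r0 (v := p0 - d1 v).
  rewrite gmod_diffB -Ey -gmod_diff_hom -Ev raddfB.
  by rewrite [d1 (d2 w)](ker_d1 _).2 ?subr0 ?subrr //; exists w.
have : eps (p0 - d1 v) = 1.
  by rewrite raddfB Ep0 [eps (d1 v)](ker_eps _).2 ?subr0 //; exists v.
rewrite Eu /gmod_norm raddf_sum.
under eq_bigr do rewrite epsJ.
rewrite sumr_const card_ord -mulr_natr natz => mu1.
have : (m%:Z %| 1)%Z by apply/dvdzP; exists (eps u); rewrite mu1.
by rewrite dvdz1 => /eqP.
Qed.

End Torsion.

Lemma resolution_torsion_free (G : groupType) :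
  (exists R : resolution2 G, True) -> torsion_free G.
Proof.
move=> [R _] x n xn.
have ex : exists k, (0 < k)%N && (x ^+ k == 1)%g by exists n.+1; rewrite xn eqxx.
case: (ex_minnP ex) => m /andP[m0 /eqP xm] m_min.
suff m1 : m = 1%N by move: xm; rewrite m1 expg1.
apply: (resolution_order1 m0 xm _ R) => k k0 xk.
by apply: m_min; rewrite k0 xk eqxx.
Qed.

(** * Finitely generated infinite torsion groups have one end *)

Lemma finite_union (I T : eqType) (r : seq I) (P : I -> T -> Prop) :
  (forall i, i \in r -> exists l : seq T, forall t, P i t -> t \in l) ->
  exists l : seq T, forall i, i \in r -> forall t, P i t -> t \in l.
Proof.
elim: r => [|i r IHr] fin; first by exists [::].
have [l lP] := fin i (mem_head _ _).
have [|l' l'P] := IHr; first by move=> j jr; apply: fin; rewrite inE jr orbT.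
exists (l ++ l') => j; rewrite inE => /orP[/eqP -> t /lP|jr t /(l'P j jr)];
  by rewrite mem_cat => ->; rewrite ?orbT.
Qed.

Section Ends.
Variables (Q : groupType) (S : seq Q).
Hypotheses (S_gen : gen [set` S] = setT)
  (Q_torsion : forall x : Q, exists n, (x ^+ n.+1 = 1)%g).

Local Notation letters := (S ++ [seq s^-1%g | s <- S]).

Let letterV s : s \in letters -> (s^-1)%g \in letters.
Proof.
rewrite !mem_cat => /orP[sS|/mapP[t tS ->]]; last by rewrite invgK tS.
by rewrite map_f // orbT.
Qed.

Definition wprod (w : seq Q) : Q := foldr (fun s q => (s * q)%g) 1%g w.

Lemma wprod_cat u v : wprod (u ++ v) = (wprod u * wprod v)%g.
Proof. by elim: u => [|s u IHu] /=; rewrite ?mul1g // IHu mulgA. Qed.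

Lemma wprodV w : wprod (rev [seq s^-1%g | s <- w]) = (wprod w)^-1%g.
Proof.
elim: w => [|s w IHw] /=; first by rewrite invg1.
by rewrite rev_cons -cats1 wprod_cat IHw /= mulg1 invgM.
Qed.

(** The ball of radius [n] around [1] in the Cayley graph whose edges join [q] to
    [s * q]. *)
Definition ball (n : nat) (q : Q) : Prop :=
  exists w, [/\ all (mem letters) w, (size w <= n)%N & wprod w = q].

Lemma ball0 n : ball n 1%g. Proof. by exists [::]. Qed.

Lemma ball0P q : ball 0 q -> q = 1%g.
Proof. by move=> [[|s w] [_ //= _ <-]]. Qed.

Lemma ballW m n q : (m <= n)%N -> ball m q -> ball n q.
Proof. by move=> mn [w [wl wm wq]]; exists w; split=> //; exact: leq_trans mn. Qed.

Lemma ballM m n p q : ball m p -> ball n q -> ball (m + n) (p * q)%g.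
Proof.
move=> [u [ul um <-]] [v [vl vn <-]]; exists (u ++ v); split.
- by rewrite all_cat ul.
- by rewrite size_cat leq_add.
- exact: wprod_cat.
Qed.

Lemma ballV n q : ball n q -> ball n q^-1%g.
Proof.
move=> [w [wl wn <-]]; exists (rev [seq s^-1%g | s <- w]); split.
- rewrite all_rev all_map; apply/allP => s sw /=; apply: letterV.
  exact: (allP wl).
- by rewrite size_rev size_map.
- exact: wprodV.
Qed.

Lemma ballS n q : ball n.+1 q ->
  ball n q \/ exists s p, [/\ s \in letters, ball n p & q = (s * p)%g].
Proof.
move=> [[|s w] [/= wl wn <-]]; first by left; exact: ball0.
by move: wl => /andP[sl wl]; right; exists s, (wprod w); split=> //; exists w.
Qed.

Lemma ball_all q : exists n, ball n q.
Proof.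
have : gen [set` S] q by rewrite S_gen.
apply: (@gen_ind_letter _ _ (fun q => exists n, ball n q)) =>
  [|a x Sa [n xn]|a x Sa [n xn]]; first by exists 0%N; exact: ball0.
- exists (1 + n)%N; apply: ballM => //; exists [:: a]; split=> //=; last by rewrite mulg1.
  by rewrite andbT mem_cat Sa.
- exists (1 + n)%N; apply: ballM => //; exists [:: a^-1%g].
  split=> //=; last by rewrite mulg1.
  by rewrite andbT; apply: letterV; rewrite mem_cat Sa.
Qed.

Lemma ball_finite n : exists l : seq Q, forall q, ball n q -> q \in l.
Proof.
elim: n => [|n [l lP]].
  by exists [:: 1%g] => q /ball0P ->; rewrite inE.
exists (l ++ [seq (s * p)%g | s <- letters, p <- l]) => q /ballS[/lP lq|].
  by rewrite mem_cat lq.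
move=> [s [p [sl /lP lp ->]]]; rewrite mem_cat; apply/orP; right.
exact: allpairs_f.
Qed.

Lemma finite_ball (l : seq Q) : exists n, forall q, q \in l -> ball n q.
Proof.
elim: l => [|q l [n nP]]; first by exists 0%N.
have [m mq] := ball_all q; exists (m + n)%N => p; rewrite inE => /orP[/eqP ->|/nP].
  by apply: ballW mq; exact: leq_addr.
by apply: ballW; exact: leq_addl.
Qed.

Definition boundary (T : Type) (f : Q -> T) (q : Q) : Prop :=
  exists2 s, s \in letters & f (s * q)%g <> f q.

(** The complement of [E] together with a ball containing the boundary of [E] is
    connected: the predecessor of one of its points on a shortest path to [1] still
    belongs to it. *)
Lemma connected_complement (E Y : Q -> bool) (R : nat) :
  (forall q, boundary E q -> ball R q) ->
  (forall q, ~~ E q \/ ball R q -> ~ boundary Y q) ->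
  forall q, ~~ E q \/ ball R q -> Y q = Y 1%g.
Proof.
move=> ER XY q Xq; have [n] := ball_all q.
elim: n q Xq => [|n IHn] q Xq; first by move=> /ball0P ->.
move=> nq; have [qn|nqn] := pselect (ball n q); first exact: IHn.
have [//|[s [p [sl np Eq]]]] := ballS nq.
have Xp : ~~ E p \/ ball R p.
  have [nE|Rq] := Xq.
    have [Ep|] := boolP (E p); last by left.
    right; apply: ER; exists s => //; rewrite -Eq Ep.
    by move=> Eqt; rewrite Eqt in nE.
  right; apply: ballW np; rewrite leqNgt; apply/negP => ltRn.
  by apply: nqn; apply: ballW Rq; exact: ltnW.
rewrite -(IHn p Xp np) Eq; apply: contrapT => sp.
by apply: (XY p Xp); exists s.
Qed.

(** A right translate of [E] far inside [E] is nested with the complement of [E]: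
    its boundary avoids the connected set of the previous lemma. *)
Lemma nested_translate (E : Q -> bool) (R : nat) (g : Q) :
  (forall q, boundary E q -> ball R q) -> E g -> ~ ball (R + R) g ->
  exists b, forall q, ~~ E q \/ ball R q -> E (q * g^-1)%g = b.
Proof.
move=> ER Eg far; exists (E (1 * g^-1)%g).
have farR b : ball R b -> ~ ball R (b * g)%g.
  move=> Rb Rbg; apply: far; rewrite -[g](mulKg b).
  by apply: ballM => //; exact: ballV.
have inE b n : (n <= R)%N -> ball n b -> E (b * g)%g.
  elim: n b => [|n IHn] b nR; first by move=> /ball0P ->; rewrite mul1g.
  move=> /ballS[nb|[s [p [sl np ->]]]]; first by apply: IHn nb; exact: ltnW.
  have Ep := IHn p (ltnW nR) np; rewrite -mulgA; apply: contrapT => nE.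
  apply: (farR p); first by apply: ballW np; exact: ltnW.
  by apply: ER; exists s => //; rewrite Ep.
apply: (connected_complement ER (Y := fun q => E (q * g^-1)%g)) => q Xq [s sl].
rewrite -mulgA => sq.
have Rqg : ball R (q * g^-1)%g by apply: ER; exists s.
have : E q by rewrite -[q](mulgVK g); exact: inE Rqg.
case: Xq => [/negP//|Rq] _; apply: (farR _ Rqg).
by rewrite mulgVK.
Qed.

(** Otherwise the translates of [E] by the powers of [g] would form an infinite
    strictly monotone chain, but [g] has finite order. *)
Lemma torsion_translate (E : Q -> bool) (g : Q) :
  (forall q, E q -> E (q * g)%g) -> forall q, E (q * g)%g -> E q.
Proof.
move=> Eg q Eqg; have [n gn] := Q_torsion g.
have En k : E (q * g * g ^+ k)%g.
  by elim: k => [|k IHk]; rewrite ?mulg1 // expgSr mulgA; exact: Eg.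
by move: (En n); rewrite -mulgA -expgS gn mulg1.
Qed.

(** If [E] and its complement were both infinite, translations far into one and the
    other would combine to a translate of [E] that strictly contains [E] or is
    strictly contained in it. *)
Lemma one_end (E : Q -> bool) :
  (forall s, s \in letters ->
     exists l : seq Q, forall q, E (s * q)%g <> E q -> q \in l) ->
  (exists l : seq Q, forall q, E q -> q \in l) \/
  (exists l : seq Q, forall q, ~~ E q -> q \in l).
Proof.
move=> almost; apply: contrapT => /not_orP[infE infE'].
have far (A : Q -> bool) : ~ (exists l : seq Q, forall q, A q -> q \in l) ->
    forall n, exists2 g, A g & ~ ball n g.
  move=> infA n; apply: contrapT => nA; apply: infA.
  have [l lP] := ball_finite n; exists l => q Aq; apply: lP.
  by apply: contrapT => nq; apply: nA; exists q.
have [R0 ER0] : exists R, forall q, boundary E q -> ball R q.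
  have [l lP] : exists l : seq Q, forall q, boundary E q -> q \in l.
    have [l lP] := finite_union almost.
    by exists l => q [s sl]; exact: lP.
  by have [R RP] := finite_ball l; exists R => q /lP/RP.
have [e Ee _] := far E infE 0%N; have [e' Ee' _] := far (fun q => ~~ E q) infE' 0%N.
have [R1 R1e] := finite_ball [:: e; e'].
pose R := (R0 + R1)%N.
have ER q : boundary E q -> ball R q by move=> /ER0; apply: ballW; exact: leq_addr.
have ER' q : boundary (fun q => ~~ E q) q -> ball R q.
  by move=> [s sl nE]; apply: ER; exists s => // E1; apply: nE; rewrite E1.
have eR : ball R e by apply: ballW (R1e _ (mem_head _ _)); exact: leq_addl.
have e'R : ball R e'.
  by apply: ballW (R1e e' _); [exact: leq_addl | rewrite !inE eqxx orbT].
have [g Eg gfar] := far E infE (R + R)%N.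
have [h Eh hfar] := far (fun q => ~~ E q) infE' (R + R)%N.
have [b bP] := nested_translate ER Eg gfar.
have [c cP] := nested_translate ER' Eh hfar.
have {}cP q : E q \/ ball R q -> E (q * h^-1)%g = ~~ c.
  by move=> Xq; rewrite -(cP q) ?negbK.
case: b bP => bP; last first.
  (* here the translate of E by g lies in E and misses e *)
  have Etr q : E (q * g^-1)%g -> E q.
    by move=> Eq; apply: contrapT => /negP nE; move: Eq; rewrite bP //; left.
  have := @torsion_translate (fun q => ~~ E q) g^-1%g.
  have Etr' q : ~~ E q -> ~~ E (q * g^-1)%g by apply: contra; exact: Etr.
  move=> /(_ Etr' e); rewrite bP; last by right.
  by move=> /(_ isT); rewrite Ee.
case: c cP => cP; last first.
  (* here the translate of E by h contains E and also e' *)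
  have Etr q : E q -> E (q * h^-1)%g by move=> Eq; rewrite cP //; left.
  have := torsion_translate Etr (q := e'); rewrite cP; last by right.
  by move=> /(_ isT); exact/negP.
(* now the translate of E by h misses E, so that by g * h contains E and e' *)
have Etr q : E q \/ ball R q -> E (q * (h^-1 * g^-1))%g.
  by move=> Xq; rewrite mulgA bP //; left; rewrite cP.
have Etr' q : E q -> E (q * (h^-1 * g^-1))%g by move=> Eq; apply: Etr; left.
have /negP := Ee'; apply; apply: (torsion_translate Etr').
by apply: Etr; right.
Qed.

Hypothesis Q_infinite : forall l : seq Q, exists q, q \notin l.

(** Outside a ball [f] is constant along the edges, hence it takes finitely many
    values. Some level set is infinite, and its complement is finite. *)
Lemma almost_invariant_constant (f : Q -> int) :
  (forall s, s \in letters ->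
     exists l : seq Q, forall q, f (s * q)%g <> f q -> q \in l) ->
  exists c, exists l : seq Q, forall q, f q <> c -> q \in l.
Proof.
move=> almost.
have [R fR] : exists R, forall q, boundary f q -> ball R q.
  have [l lP] := finite_union almost.
  have [R RP] := finite_ball l.
  by exists R => q [s sl fq]; apply/RP/(lP s sl).
have [l lP] := ball_finite R.
have fval q : exists2 p, p \in l & f p = f q.
  have [n] := ball_all q; elim: n q => [|n IHn] q.
    by move=> /ball0P ->; exists 1%g => //; apply/lP/ball0.
  move=> /ballS[/IHn//|[s [p [sl np Eq]]]].
  have [Rq|nRq] := pselect (ball R q); first by exists q => //; exact: lP.
  have [r rl fr] := IHn p np; exists r => //; rewrite fr Eq.
  apply: contrapT => fsp; apply: nRq; rewrite Eq.
  have : boundary f (s * p)%g.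
    exists s^-1%g; first exact: letterV.
    by rewrite mulKg.
  exact: fR.
apply: contrapT => nc.
have levels c : exists t : seq Q, forall q, f q = c -> q \in t.
  have [s sl|[t tP]|[t tP]] := one_end (E := fun q => f q == c).
  - have [t tP] := almost s sl; exists t => q nE; apply: tP => fq.
    by apply: nE; rewrite fq.
  - by exists t => q /eqP; exact: tP.
  - by case: nc; exists c, t => q /eqP; exact: tP.
have [|t tP] := @finite_union _ _ l (fun p q => f p = f q).
  by move=> p _; have [t tP] := levels (f p); exists t => q /esym/tP.
have [q /negP] := Q_infinite t; apply.
by have [p pl fp] := fval q; exact: tP fp.
Qed.

(** On the functions with arbitrary support the derivation [D] is the coboundary of
    [f], where [f x q] is minus the coefficient of [D q] at [(x, q)]; each [f x] is
    almost invariant, and invariant for almost all [x]. Subtracting the constants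
    from the previous lemma leaves a function of finite support. In other words, the
    first cohomology of [Q] with coefficients in a free module vanishes. *)
Lemma derivation_inner (X : choiceType) (D : Q -> free_gmod Q X) :
  (forall g h, D (g * h)%g = D g + gmod_act (free_gmod Q X) g (D h)) ->
  exists y : free_gmod Q X, forall g, D g = gmod_diff g y.
Proof.
move=> Dder; pose f x q : int := - coeff (x, q) (D q).
have Df g x q : coeff (x, q) (D g) = f x (g^-1 * q)%g - f x q.
  have := Dder g (g^-1 * q)%g; rewrite mulVKg => /(congr1 (coeff (x, q))).
  rewrite coeffD coeff_free_actV => Eq.
  by rewrite /f opprK Eq addrC addrK.
have almost x s : s \in letters ->
    exists l : seq Q, forall q, f x (s * q)%g <> f x q -> q \in l.
  move=> sl; exists [seq u.2 | u <- dom (D s^-1%g)] => q fq.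
  apply/mapP; exists (x, q) => //; rewrite mem_dom Df invgK subr_eq0.
  exact/eqP.
have /choice[c /choice[l lP]] : forall x, exists c, exists l : seq Q,
    forall q, f x q <> c -> q \in l.
  by move=> x; apply: almost_invariant_constant; exact: almost.
pose X0 := [seq u.1 | u <- flatten [seq dom (D s^-1%g) | s <- letters]].
have fX0 x : x \notin X0 -> forall q, f x q = c x.
  move=> xX0 q.
  have f1 p : f x p = f x 1%g.
    have [n] := ball_all p; elim: n p => [|n IHn] p; first by move=> /ball0P ->.
    move=> /ballS[/IHn//|[s [r [sl nr ->]]]]; rewrite -(IHn r nr).
    apply/eqP; rewrite -subr_eq0 -{1}[s]invgK -Df; apply: contraR xX0 => nz.
    apply/mapP; exists (x, r) => //; apply/flattenP.
    exists (dom (D s^-1%g)); last by rewrite mem_dom.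
    exact: (map_f (fun s => dom (D s^-1%g)) sl).
  have [p pl] := Q_infinite (l x).
  rewrite f1 -(f1 p); apply: contrapT => /lP.
  by apply/negP.
have [|y Ey] := @freeg_of_fun _ (fun u : X * Q => f u.1 u.2 - c u.1)
    [seq (x, q) | x <- X0, q <- l x].
  move=> [x q] /=; rewrite subr_eq0 => /eqP fq.
  have [xX0|xX0] := boolP (x \in X0); last by case: fq; exact: fX0.
  exact/allpairsPdep/(ex_intro _ x)/(ex_intro _ q)/And3/erefl/lP/fq.
exists y => g; apply: freegP => -[x q].
rewrite Df /gmod_diff coeffB coeff_free_actV !Ey /=.
by rewrite opprB addrA subrK.
Qed.

End Ends.

(** * Quotient groups *)

Section Quotient.
Variables (K : groupType) (N : set K).
Hypotheses (Ngrp : is_subgroup N) (Nnormal : forall x g, N x -> N (x ^ g)%g).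

Let rep : K -> K := sval (cid (coset_representatives Ngrp)).
Let repP x : N (x / rep x)%g.
Proof. by rewrite /rep; case: cid => r []. Qed.
Let repM n x : N n -> rep (n * x)%g = rep x.
Proof. by rewrite /rep; case: cid => r /= [_ rM]; exact: rM. Qed.

Let rep_rep x : rep (rep x) = rep x.
Proof. by rewrite -[in RHS](mulgVK (rep x) x) repM. Qed.

Let rep_mull x y : rep (rep x * y)%g = rep (x * y)%g.
Proof. by rewrite -[in RHS](mulgVK (rep x) x) -mulgA [RHS]repM. Qed.

Let rep_mulr x y : rep (x * rep y)%g = rep (x * y)%g.
Proof.
have -> : (x * y = (y / rep y) ^ x^-1 * (x * rep y))%g.
  by rewrite mulgA -conjgCV -mulgA mulgVK.
by rewrite [RHS]repM //; exact: Nnormal.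
Qed.

(** Carried by representatives of the cosets of [N]. *)
Definition quotient_type of is_subgroup N : Type := {x : K | rep x == x}.
Local Notation T := (quotient_type Ngrp).
HB.instance Definition _ := Choice.on T.

Let quotient_eq (u v : T) : sval u = sval v -> u = v.
Proof.
case: u v => [x xP] [y yP] /= eq_xy; case: y / eq_xy yP => yP.
by congr exist; exact: bool_irrelevance.
Qed.

Let cls x : T := exist _ (rep x) (introT eqP (rep_rep x)).
Let svalK (u : T) : rep (sval u) = sval u.
Proof. by case: u => x /= /eqP. Qed.

Let quotient_mul (u v : T) : T := cls (sval u * sval v)%g.
Let quotient_inv (u : T) : T := cls (sval u)^-1%g.

Fact quotient_mulA : associative quotient_mul.
Proof. by move=> u v w; apply: quotient_eq; rewrite /= rep_mull rep_mulr mulgA. Qed.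
Fact quotient_mul1 : left_id (cls 1%g) quotient_mul.
Proof. by move=> u; apply: quotient_eq; rewrite /= rep_mull mul1g svalK. Qed.
Fact quotient_mulr1 : right_id (cls 1%g) quotient_mul.
Proof. by move=> u; apply: quotient_eq; rewrite /= rep_mulr mulg1 svalK. Qed.
Fact quotient_mulV : left_inverse (cls 1%g) quotient_inv quotient_mul.
Proof. by move=> u; apply: quotient_eq; rewrite /= rep_mull mulVg. Qed.
Fact quotient_mulrV : right_inverse (cls 1%g) quotient_inv quotient_mul.
Proof. by move=> u; apply: quotient_eq; rewrite /= rep_mulr mulgV. Qed.

HB.instance Definition _ := isGroup.Build T quotient_mulA quotient_mul1
  quotient_mulr1 quotient_mulV quotient_mulrV.

Lemma quotient_exists : exists (Q : groupType) (p : group_hom K Q),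
  (forall q, exists x, p x = q) /\ (forall x, p x = 1%g <-> N x).
Proof.
have clsM : {morph (cls : K -> T) : x y / (x * y)%g}.
  by move=> x y; apply: quotient_eq; rewrite /= rep_mull rep_mulr.
exists T, (hom_of_morph clsM); split=> [u|x].
  by exists (sval u); apply: quotient_eq; rewrite /= svalK.
split=> [/(congr1 sval) /= E|Nx].
  rewrite -(mulgVK (rep x) x) E.
  have := repP 1%g; rewrite div1g => /(subgroupV Ngrp); rewrite invgK.
  by rewrite -E; apply: (subgroupM Ngrp); exact: repP.
by apply: quotient_eq; rewrite /= -[x in LHS]mulg1 repM.
Qed.

End Quotient.

(** * Groups with a central element and torsion quotient *)

Lemma avoid_finite (T : eqType) (c : nat -> T) (l : seq T) :
  injective c -> exists n, c n \notin l.
Proof.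
move=> c_inj; apply: contrapT => all_in.
have : (size [seq c n | n <- iota 0 (size l).+1] <= size l)%N.
  apply: uniq_leq_size; first by rewrite map_inj_uniq // iota_uniq.
  move=> _ /mapP[n _ ->]; apply/negPn/negP => nl.
  by apply: all_in; exists n.
by rewrite size_map size_iota ltnn.
Qed.

Section FreeActions.
Variable K : groupType.

(** The coefficients of [v] are constant along the orbits of [b], which are
    infinite. *)
Lemma free_diff_inj (X : choiceType) (b : K) (v : free_gmod K X) :
  torsion_free K -> b <> 1%g -> gmod_diff b v = 0 -> v = 0.
Proof.
move=> tf b1 /eqP; rewrite subr_eq0 => /eqP bv.
apply: freegP => -[x k]; rewrite coeff0.
have inv n : coeff (x, (b ^+ n * k)%g) v = coeff (x, k) v.
  elim: n => [|n IHn]; first by rewrite mul1g.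
  by rewrite expgS -mulgA -{1}bv coeff_free_act.
have [|n] := @avoid_finite _ (fun n => (x, (b ^+ n * k)%g)) (dom v).
  move=> m n [/mulIg E]; by have /(expgz_inj tf b1)[] : expgz b m = expgz b n := E.
by rewrite mem_dom negbK inv => /eqP.
Qed.

Lemma retract_diff_inj (P : gmodule K) (b : K) (v : P) : retract_of_free P ->
  torsion_free K -> b <> 1%g -> gmod_diff b v = 0 -> v = 0.
Proof.
move=> [X [i [r iK]]] tf b1 bv; rewrite -[v]iK.
rewrite (@free_diff_inj X b (i v)) ?raddf0 //.
by rewrite -gmod_diff_hom bv raddf0.
Qed.

Lemma free_invariant0 (X : choiceType) (v : free_gmod K X) :
  (forall l : seq K, exists k, k \notin l) ->
  (forall g, gmod_diff g v = 0) -> v = 0.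
Proof.
move=> inf inv; apply: freegP => -[x k]; rewrite coeff0.
have [g] := inf [seq (u.2 / k)%g | u <- dom v].
apply: contraNeq => vk; apply/mapP; exists (x, (g * k)%g); last by rewrite /= mulgK.
have /eqP := inv g; rewrite subr_eq0 => /eqP gv.
by rewrite mem_dom -gv coeff_free_act.
Qed.

End FreeActions.

Section CentralQuotient.
Variables (K Q : groupType) (p : group_hom K Q) (h : K).
Hypotheses (p_surj : forall q, exists x, p x = q)
  (p_ker : forall x, p x = 1%g <-> exists n, expgz h n = x)
  (h_central : forall x : K, commute x h).

Let ph : p h = 1%g.
Proof. by apply/p_ker; exists 1%R. Qed.

Let s (q : Q) : K := sval (cid (p_surj q)).
Let sK q : p (s q) = q.
Proof. by rewrite /s; case: cid. Qed.

Let sP x : exists n, (x = expgz h n * s (p x))%g.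
Proof.
have [|n En] := (p_ker (x / s (p x))%g).1; first by rewrite gmulfF sK mulgV.
by exists n; rewrite En mulgVK.
Qed.

Section Push.
Variable X : choiceType.
Local Notation F := (free_gmod K X).
Local Notation FQ := (res_gmod p (free_gmod Q X)).

Let push_fun : {additive F -> FQ} := freeg_map (fun u : X * K => (u.1, p u.2)).
Let pushE x k : push_fun (delta (x, k)) = delta (x, p k).
Proof. exact: freeg_map_delta. Qed.

Fact pushJ g v : push_fun (gmod_act F g v) = gmod_act FQ g (push_fun v).
Proof.
have : push_fun \o gmod_act F g =1 gmod_act FQ g \o push_fun.
  apply: freeg_additive_eq => -[x k]; rewrite [LHS]/= [RHS]/= pushE.
  rewrite (_ : free_act X g _ = delta (x, (g * k)%g)) ?pushE ?gmulfM; last first.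
    exact: freeg_map_delta.
  exact/esym/freeg_map_delta.
by apply.
Qed.

(** The reduction of a free module modulo [h - 1]. *)
Definition push : gmod_hom F FQ := GModHom pushJ.

Lemma push_surj v : exists w, push w = v.
Proof.
elim/freeg_ind: v => [[x q]||u v [w <-] [w' <-]|u [w <-]].
- by exists (delta (x, s q)); rewrite [LHS]pushE sK.
- by exists 0; rewrite raddf0.
- by exists (w + w'); rewrite raddfD.
- by exists (- w); rewrite raddfN.
Qed.

Lemma push_diff v : push (gmod_diff h v) = 0.
Proof.
rewrite gmod_diff_hom /gmod_diff /= ph; apply/eqP; rewrite subr_eq0; apply/eqP.
exact: free_act1.
Qed.

(** Every basis element is congruent modulo [h - 1] to the chosen lift of its
    image. *)
Lemma push_ker v : push v = 0 -> exists w, v = gmod_diff h w.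
Proof.
pose lft : {additive {freeg (X * Q)%type / int} -> F} :=
  freeg_map (fun u : X * Q => (u.1, s u.2)).
suff [w Ew] : exists w, v - lft (push v) = gmod_diff h w.
  by move=> v0; exists w; rewrite -Ew v0 raddf0 subr0.
elim/freeg_ind: v => [[x k]||u v [w Ew] [w' Ew']|u [w Ew]].
- have [n En] := sP k.
  have [w Ew] := gmod_diff_expgz h n (delta (x, s (p k)) : F).
  exists w; rewrite -Ew [push _]pushE [lft _]freeg_map_delta free_gmod_delta.
  by rewrite -En.
- by exists 0; rewrite [push _]raddf0 [lft _]raddf0 subrr gmod_diff0.
- exists (w + w'); rewrite gmod_diffD -Ew -Ew'.
  by rewrite [push _]raddfD [lft (_ + _)]raddfD opprD addrACA.
- by exists (- w); rewrite gmod_diffN -Ew [push _]raddfN [lft (- _)]raddfN opprD.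
Qed.

End Push.

End CentralQuotient.

Definition gmod_diff_central (K : groupType) (h : K)
  (h_central : forall x : K, commute x h) (M : gmodule K) : gmod_hom M M :=
  mk_gmod_hom (@gmod_diffD K M h) (fun g v => esym (gmod_diff_act v (h_central g))).

Section CentralTorsion.
Variables (K : groupType) (S : seq K) (R : resolution2 K) (h : K).
Hypotheses (K_gen : gen [set` S] = setT) (K_tf : torsion_free K)
  (h_central : forall x : K, commute x h) (h1 : h <> 1%g).
Variables (Q : groupType) (p : group_hom K Q).
Hypotheses (p_surj : forall q, exists x, p x = q)
  (p_ker : forall x, p x = 1%g <-> exists n, expgz h n = x)
  (Q_torsion : forall q : Q, exists n, (q ^+ n.+1 = 1)%g)
  (Q_infinite : forall l : seq Q, exists q, q \notin l).

Local Notation P0 := (res0 R).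
Local Notation P1 := (res1 R).
Local Notation P2 := (res2 R).
Local Notation d1 := (res_d1 R).
Local Notation d2 := (res_d2 R).
Local Notation eps := (res_eps R).

Let hC x := commute_sym (h_central x).

Lemma d1d2 z : d1 (d2 z) = 0. Proof. by apply/res_ker_d1; exists z. Qed.
Lemma epsd1 y : eps (d1 y) = 0. Proof. by apply/res_ker_eps; exists y. Qed.

Lemma eps_diff g v : eps (gmod_diff g v) = 0.
Proof. by rewrite /gmod_diff raddfB res_epsJ subrr. Qed.

Lemma diff_h_inj (M : gmodule K) : retract_of_free M -> injective (@gmod_diff K M h).
Proof.
move=> rM u v uv; apply/eqP; rewrite -subr_eq0; apply/eqP.
by apply: (retract_diff_inj rM K_tf h1); rewrite gmod_diffB uv subrr.
Qed.

Lemma K_infinite (l : seq K) : exists k, k \notin l.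
Proof.
have [q ql] := Q_infinite [seq p k | k <- l]; have [k Ek] := p_surj q.
by exists k; apply: contra ql; rewrite -Ek; exact: map_f.
Qed.

Let Q_gen : gen [set` [seq p x | x <- S]] = setT.
Proof.
apply/seteqP; split=> // q _; have [x <-] := p_surj q.
have : gen [set` S] x by rewrite K_gen.
have gg := gen_subgroup [set` [seq p x | x <- S]].
move: x; apply: (@gen_ind _ _ (fun x => gen _ (p x))) => [|x Sx|x y|x].
- by rewrite gmulf1; exact: gen1.
- by apply: sub_gen => /=; exact: map_f.
- by rewrite gmulfM; exact: (subgroupM gg).
- by rewrite gmulfV; exact: (subgroupV gg).
Qed.

(** A homomorphism on [P1] that kills the boundaries is a homomorphism on the
    augmentation kernel of [P0]; its values at the elements [(g - 1) p0] form a
    derivation. *)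
Lemma boundary_derivation (M : gmodule K) (u : gmod_hom P1 M) (p0 : P0) :
  (forall z, u (d2 z) = 0) -> exists D : K -> M,
  (forall g y, d1 y = gmod_diff g p0 -> D g = u y) /\
  (forall g k, D (g * k)%g = D g + gmod_act M g (D k)).
Proof.
move=> ud2.
have uE y y' : d1 y = d1 y' -> u y = u y'.
  move=> E; apply/eqP; rewrite -subr_eq0 -raddfB; apply/eqP.
  have [|z <-] := (res_ker_d1 (y - y')).1; last exact: ud2.
  by rewrite raddfB E subrr.
have /choice[Y YP] : forall g, exists y, d1 y = gmod_diff g p0.
  by move=> g; apply/res_ker_eps; exact: eps_diff.
exists (fun g => u (Y g)); split=> [g y Ey|g k]; first by apply: uE; rewrite YP.
rewrite -gmod_homJ -raddfD; apply: uE; rewrite YP raddfD gmod_homJ !YP.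
by rewrite /gmod_diff gmod_actM raddfB [RHS]addrC subrKA.
Qed.

(** [h - 1] acts as zero on the homology of the resolution, hence is null-homotopic
    there. *)
Lemma central_homotopy : exists (s0 : gmod_hom P0 P1) (s1 : gmod_hom P1 P2),
  (forall v, d1 (s0 v) = gmod_diff h v) /\
  (forall y, d2 (s1 y) = gmod_diff h y - s0 (d1 y)) /\
  (forall z, s1 (d2 z) = gmod_diff h z).
Proof.
have [|s0 s0P] := retract_lift (p := d1) (f := gmod_diff_central h_central P0)
  (res0_retract R).
  by move=> v; apply/res_ker_eps; exact: eps_diff.
have [| | | | |s1 s1P] := @gmod_hom_of_rel K P1 P2
    (fun y z => d2 z = gmod_diff h y - s0 (d1 y)).
- move=> y; apply/res_ker_d1; rewrite raddfB s0P gmod_diff_hom.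
  exact: subrr.
- move=> z Ez; apply: (@res_d2_inj _ R).
  by rewrite Ez gmod_diff0 !raddf0 ?addr0 ?subr0.
- by move=> y y' z z' Ez Ez'; rewrite !raddfD Ez Ez' gmod_diffD ?opprD addrACA.
- move=> y z Ez; rewrite gmod_diffN [d1 _]raddfN [s0 _]raddfN [d2 _]raddfN Ez.
  by rewrite opprD.
- move=> g y z Ez; rewrite !gmod_homJ Ez raddfB gmod_diff_act //.
exists s0, s1; split=> //; have s1E y := (s1P y _).2 erefl.
split=> // z; apply/s1P.
by rewrite d1d2 raddf0 ?oppr0 ?addr0 gmod_diff_hom.
Qed.

(** Let [F] be a free module with retract [P2], embedded by [i2]. Dividing [i2 s1] by
    [h - 1] would extend [i2] to [P1]; modulo [h - 1] this fails by a homomorphism on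
    the augmentation kernel, that is, by a derivation of [Q] with values in a free
    module over [Q]. As the derivation is inner, [i2 s1] becomes divisible after
    subtraction of a map [psi] that factors through [d1]. In terms of cohomology,
    [H^2(K, F) = H^1(Q, F / (h - 1)) = 0]. *)
Lemma top_splits : exists r : gmod_hom P1 P2, cancel d2 r.
Proof.
have [s0 [s1 [s0P [s1P s1d2]]]] := central_homotopy.
have [X [i2 [r2 i2K]]] := res2_retract R.
pose tau := push p X.
have tau_diff v : tau (gmod_diff h v) = 0 by exact: (push_diff p_ker).
pose FQ := res_gmod p (free_gmod Q X).
pose u : gmod_hom P1 FQ := gmod_comp tau (gmod_comp i2 s1).
have ud2 z : u (d2 z) = 0 by rewrite /= s1d2 gmod_diff_hom; exact: tau_diff.
have [p0 Ep0] := res_eps_surj R.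
have [D [DE DM]] := boundary_derivation p0 ud2.
have hFQ (v : FQ) : gmod_act FQ h v = v.
  have E : p h = 1%g by apply/p_ker; exists 1%R.
  by rewrite [LHS]/= E; exact: free_act1.
have Dh : D h = 0.
  apply: (@free_invariant0 Q X) => // q; have [g <-] := p_surj q.
  have := DM g h; rewrite h_central DM hFQ addrC => /addrI E.
  by apply/eqP; rewrite subr_eq0; apply/eqP/esym.
have D1 : D 1%g = 0.
  by have /eqP := DM 1%g 1%g; rewrite mulg1 gmod_act1 addrC -subr_eq subrr eq_sym => /eqP.
have Dker g n : D (g * expgz h n)%g = D g.
  have D0 k : D k = 0 -> D k^-1%g = 0.
    move=> Dk; have := DM k^-1%g k; rewrite mulVg D1 Dk raddf0 addr0.
    by [].
  have Dn : D (expgz h n) = 0.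
    have DX k : D (h ^+ k)%g = 0.
      by elim: k => [|k IHk]; rewrite ?D1 // expgS DM Dh IHk raddf0 addr0.
    by case: n => k; rewrite /expgz; [|apply: D0]; exact: DX.
  by rewrite DM Dn raddf0 addr0.
have Dp g k : p g = p k -> D g = D k.
  move=> E; have [|n En] := (p_ker (k^-1 * g)%g).1; last first.
    by rewrite -(Dker k n) En mulVKg.
  by rewrite gmulfM gmulfV E mulVg.
have /choice[s sP] := p_surj.
have [|y0 Dy0] := @derivation_inner Q _ Q_gen Q_torsion Q_infinite X
    (fun q => D (s q)).
  move=> q q'; rewrite (Dp _ (s q * s q')%g) ?gmulfM ?sP // DM.
  by congr (_ + _); rewrite [LHS]/= sP.
have {}Dy0 g : D g = gmod_diff g (y0 : FQ).
  by rewrite (Dp g (s (p g))) ?sP // Dy0.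
have [| | | | |theta thetaP] := @gmod_hom_of_rel K P0 FQ
    (fun v z => exists2 y, d1 y = v - p0 *~ eps v & z = u y + y0 *~ eps v).
- move=> v; have [|y Ey] := (res_ker_eps (v - p0 *~ eps v)).1.
    by rewrite raddfB raddfMz Ep0 intz subrr.
  by exists (u y + y0 *~ eps v), y.
- move=> z [y]; rewrite raddf0 !mulr0z subr0 addr0.
  by move=> /res_ker_d1[w <-] ->.
- move=> v v' z z' [y Ey ->] [y' Ey' ->]; exists (y + y').
    by rewrite !raddfD Ey Ey' ?mulrzDr ?opprD addrACA.
  by rewrite !raddfD ?mulrzDr addrACA.
- move=> v z [y Ey ->]; exists (- y).
    by rewrite [d1 _]raddfN [eps _]raddfN Ey mulrNz !opprD.
  by rewrite [u (- y)]raddfN [eps (- v)]raddfN mulrNz opprD.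
- move=> g v z [y Ey ->].
  have [|yg Eyg] := (res_ker_eps (gmod_diff g p0)).1; first exact: eps_diff.
  exists (gmod_act P1 g y + yg *~ eps v).
    rewrite raddfD gmod_homJ Ey raddfMz Eyg raddfB raddfMz res_epsJ.
    by rewrite /gmod_diff mulrzBl subrKA.
  rewrite [u (_ + _)]raddfD [u (gmod_act _ _ _)]gmod_homJ [u (_ *~ _)]raddfMz.
  rewrite -(DE g yg Eyg) Dy0 res_epsJ [LHS]raddfD [gmod_act _ _ (y0 *~ _)]raddfMz.
  by rewrite /gmod_diff mulrzBl -addrA subrK.
have theta_d1 y : theta (d1 y) = u y.
  by apply/thetaP; exists y; rewrite epsd1 !mulr0z ?subr0 ?addr0.
have [|psi psiP] := retract_lift (p := tau) (f := theta) (res0_retract R).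
  by move=> v; exact: (push_surj p_surj).
have [| | | | |Phi PhiP] := @gmod_hom_of_rel K P1 (free_gmod K X)
    (fun y w => gmod_diff h w = i2 (s1 y) - psi (d1 y)).
- move=> y; have [|w Ew] := push_ker p_surj p_ker (v := i2 (s1 y) - psi (d1 y)).
    by rewrite raddfB psiP theta_d1; exact: subrr.
  by exists w.
- move=> w; rewrite !raddf0 ?oppr0 ?addr0 => Ew.
  exact: free_diff_inj K_tf h1 Ew.
- by move=> y y' w w' Ew Ew'; rewrite gmod_diffD Ew Ew' !raddfD ?opprD addrACA.
- move=> y w Ew; rewrite gmod_diffN Ew [s1 (- _)]raddfN [i2 (- _)]raddfN [d1 (- _)]raddfN.
  by rewrite [psi (- _)]raddfN opprD.
- by move=> g y w Ew; rewrite -gmod_diff_act // Ew raddfB !gmod_homJ.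
exists (gmod_comp r2 Phi) => z /=.
rewrite -[RHS]i2K; congr (r2 _); apply/PhiP.
by rewrite d1d2 raddf0 ?oppr0 ?addr0 s1d2 gmod_diff_hom.
Qed.

(** Once [P2] splits off, the same argument one degree lower shows that the
    augmentation [P0 -> Z] has an equivariant section, whose value at [1] is a
    non-zero invariant of a projective module over an infinite group. *)
Lemma central_torsion_absurd : False.
Proof.
have [r rK] := top_splits.
have [X [i1 [r1 i1K]]] := res1_retract R.
pose e : gmod_hom P1 P1 := gmod_sub (gmod_id P1) (gmod_comp d2 r).
have eE y : e y = y - d2 (r y) by [].
have [p0 Ep0] := res_eps_surj R.
have [|D [DE DM]] := @boundary_derivation _ (gmod_comp i1 e) p0.
  have ed2 z : e (d2 z) = 0 by rewrite eE rK subrr.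
  by move=> z; rewrite -[RHS](raddf0 i1) -(ed2 z).
have Dh g : gmod_diff h (D g) = gmod_diff g (D h).
  have E := DM g h; rewrite h_central DM in E.
  apply/eqP; rewrite /gmod_diff subr_eq addrAC eq_sym subr_eq.
  by rewrite [X in X == _]addrC -E addrC.
have [|y0 Ey0] := push_ker p_surj p_ker (v := D h).
  apply: (@free_invariant0 Q X) => // q; have [g <-] := p_surj q.
  have := push_diff p_ker (D g).
  by rewrite Dh gmod_diff_hom.
have {}Dh g : D g = gmod_diff g y0.
  apply: (diff_h_inj (free_retract _ _)); rewrite Dh Ey0.
  exact: gmod_diffC.
pose e0 := p0 - d1 (r1 y0).
have e00 : e0 = 0.
  have [X0 [i0 [r0 i0K]]] := res0_retract R.
  rewrite -[e0]i0K (_ : i0 e0 = 0) ?raddf0 //.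
  apply: (@free_invariant0 K X0 _ K_infinite) => g; rewrite -gmod_diff_hom.
  rewrite (_ : gmod_diff g e0 = 0) ?raddf0 //.
  have [|y Ey] := (res_ker_eps (gmod_diff g p0)).1; first exact: eps_diff.
  rewrite /e0 gmod_diffB -Ey -gmod_diff_hom -gmod_diff_hom -Dh (DE g y Ey).
  by rewrite [r1 _]i1K eE raddfB d1d2 subr0 subrr.
have := congr1 eps e00; rewrite raddfB Ep0 epsd1 subr0 raddf0.
by [].
Qed.

End CentralTorsion.

(** * Commutative transitivity *)

Section Transfer.
Variables (K Q : groupType) (p : group_hom K Q) (h : K).
Hypotheses (K_tf : torsion_free K) (h_central : forall x : K, commute x h)
  (h1 : h <> 1%g) (p_surj : forall q, exists x, p x = q)
  (p_ker : forall x, p x = 1%g <-> exists n, expgz h n = x)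
  (Q_torsion : forall q : Q, exists n, (q ^+ n.+1 = 1)%g).

(** The transfer [K -> <h>] restricts to a non-trivial power map on [<h>], which
    contains a power of every element. As [K] is torsion-free, the transfer is
    injective. *)
Lemma finite_central_quotient_abelian (l : seq Q) :
  (forall q, q \in l) -> abelian_group K.
Proof.
move=> lP; have /choice[s sP] := p_surj.
have l_uniq := undup_uniq l; have {lP} : forall q, q \in undup l.
  by move=> q; rewrite mem_undup.
move: (undup l) l_uniq => {}l l_uniq lP.
have cex (u : K * Q) : exists n, (u.1 * s u.2 = s (p u.1 * u.2) * expgz h n)%g.
  have [|n En] := (p_ker ((s (p u.1 * u.2))^-1 * (u.1 * s u.2))%g).1.
    by rewrite gmulfM gmulfV gmulfM !sP mulVg.
  by exists n; rewrite En mulVKg.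
have /choice[c cP] := cex.
pose V x : int := \sum_(q <- l) c (x, q).
have cE x q n : (x * s q = s (p x * q) * expgz h n)%g -> c (x, q) = n.
  by have /= -> := cP (x, q) => /mulgI /(expgz_inj K_tf h1).
have VM x y : V (x * y)%g = V x + V y.
  have -> : V x = \sum_(q <- l) c (x, (p y * q)%g).
    rewrite -(big_map (fun q => (p y * q)%g) xpredT (fun q => c (x, q))) /=.
    apply: perm_big; apply: uniq_perm => //.
      by rewrite map_inj_uniq // => q q' /mulgI.
    move=> q; rewrite lP; apply/esym/mapP; exists ((p y)^-1 * q)%g => //.
    by rewrite mulVKg.
  rewrite -big_split /=; apply: eq_bigr => q _; apply: cE.
  have /= E1 := cP (y, q); have /= E2 := cP (x, (p y * q)%g).
  by rewrite -mulgA E1 mulgA E2 gmulfM -mulgA expgzD -[in RHS]mulgA.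
have Vh : V h = (size l)%:Z.
  rewrite /V (eq_bigr (fun=> 1)) => [|q _].
    by rewrite big_const_seq count_predT iter_addr_0 natz.
  apply: cE; rewrite (_ : p h = 1%g) ?mul1g; last by apply/p_ker; exists 1%R.
  by rewrite expgz1 -h_central.
have l0 : (size l)%:Z != 0 by have := lP 1%g; case: (l).
pose W : group_hom K Zgroup := @hom_of_morph K Zgroup V VM.
have VX x (n : int) : V (expgz x n) = V x * n.
  rewrite -[LHS]/(W (expgz x n)) hom_expgz -[W x]expgz_Zgroup -expgzM.
  exact: expgz_Zgroup.
have V_inj x : V x = 0 -> x = 1%g.
  move=> Vx; have [n pxn] := Q_torsion (p x).
  have [|k Ek] := (p_ker (expgz x n.+1%:Z)).1; first by rewrite hom_expgz.
  have := VX x n.+1%:Z; rewrite Vx mul0r -Ek VX Vh => /eqP.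
  rewrite mulf_eq0 (negPf l0) /= => /eqP k0.
  by move: Ek; rewrite k0 => /esym/(torsion_free_expgz K_tf)[].
move=> x y; apply: divg1_eq; apply: V_inj.
have -> : V ((x * y) / (y * x))%g = V (x * y)%g - V (y * x)%g.
  by rewrite VM -(expgzN1 (y * x)) VX mulrN1.
by rewrite !VM [V y + _]addrC subrr.
Qed.
End Transfer.

(** Otherwise [x] and [t] span a copy of [BS(1, 1)]. *)
Lemma commuting_dependent (G : groupType) (x t : G) :
  torsion_free G -> BS_free G -> x <> 1%g -> commute x t ->
  exists i j : int, i <> 0 /\ expgz t i = expgz x j.
Proof.
move=> tf bs x1 cxt; apply: contrapT => indep.
apply: (@contains_BS1 G x t 1) bs => //.
  by apply/conjg_fixP/commgP.
move=> i j E; apply: contrapT => i0; apply: indep; by exists i, j.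
Qed.

Lemma expgz_eq1 (G : groupType) (x : G) (i : int) :
  i <> 0 -> expgz x i = 1%g -> exists n, (x ^+ n.+1 = 1)%g.
Proof.
case: i => [[//|n]|n] _ E; exists n => //.
by apply/eqP; rewrite -invg_eq1; apply/eqP.
Qed.

Lemma subgroup_type_gen (G : groupType) (s : seq G) :
  exists S : seq (subgroup_type (gen_subgroup [set` s])),
    map sval S = s /\ gen [set` S] = setT.
Proof.
set K := subgroup_type _.
have lift (t : seq G) : (forall x, x \in t -> gen [set` s] x) ->
    exists S : seq K, map sval S = t.
  elim: t => [|x t IHt] xt; first by exists [::].
  have [|S ES] := IHt; first by move=> y yt; apply: xt; rewrite inE yt orbT.
  by exists (subgroup_elt (gen_subgroup _) (xt x (mem_head _ _)) :: S); rewrite /= ES.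
have [|S ES] := lift s; first exact: sub_gen.
exists S; split=> //; apply/seteqP; split=> // u _.
have gg := gen_subgroup [set` S].
have [v gv /subgroup_type_eq <- //] : exists2 v : K, gen [set` S] v & sval v = sval u.
have := subgroup_typeP u; move: (sval u).
apply: (@gen_ind _ _ (fun x => exists2 v : K, gen [set` S] v & sval v = x)).
- by exists 1%g => //; exact: gen1.
- move=> x xs; have /mapP[v Sv ->] : x \in map sval S by rewrite ES.
  by exists v => //; exact: sub_gen.
- move=> x y [v gv <-] [w gw <-]; exists (v * w)%g => //.
  exact: (subgroupM gg).
- by move=> x [v gv <-]; exists v^-1%g => //; exact: (subgroupV gg).
Qed.

(** If [h] commutes with [g] and [k], it is central in the subgroup [K] generated by
    [g], [h] and [k]. Every element of [K] has a power in [<h>], because [G] contains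
    no copy of [BS(1, 1)]. So [K / <h>] is a finitely generated torsion group, hence
    finite, and then [K] is abelian. *)
Lemma BS_free_commutative_transitive (G : groupType) :
  (exists R : resolution2 G, True) -> BS_free G -> commutative_transitive G.
Proof.
move=> resG bs; have tf := resolution_torsion_free resG.
move=> g h k g1 h1 k1 /commuteP cgh /commuteP chk; apply/commuteP.
pose s := [:: g; h; k]; pose gg := gen_subgroup [set` s].
pose K := subgroup_type gg.
have elt x : x \in s -> exists u : K, sval u = x.
  by move=> xs; exists (subgroup_elt gg (sub_gen xs)).
have [g' Eg] : exists u : K, sval u = g by apply: elt; rewrite !inE eqxx.
have [h' Eh] : exists u : K, sval u = h by apply: elt; rewrite !inE eqxx orbT.
have [k' Ek] : exists u : K, sval u = k by apply: elt; rewrite !inE eqxx !orbT.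
have [S [_ K_gen]] := subgroup_type_gen s.
have [R _] := restrict_resolution (@subgroup_incl_inj _ _ gg) resG.
have K_tf : torsion_free K by apply: resolution_torsion_free; exists R.
have h'1 : h' <> 1%g by move=> E; apply: h1; rewrite -Eh E.
have hC (x : K) : commute x h'.
  have cs : [set` s] `<=` [set y | commute h y].
    by move=> y /=; rewrite !inE => /or3P[] /eqP -> //; exact: commute_sym.
  have chx : commute h (sval x).
    exact: (gen_min (cent_subgroup h) cs (subgroup_typeP x)).
  by apply: subgroup_type_eq; rewrite /= Eh -chx.
have Nnormal (x y : K) : range (expgz h') x -> range (expgz h') (x ^ y)%g.
  move=> [n _ <-]; exists n => //; rewrite expgzJ; congr expgz.
  by apply/esym/conjg_fixP/commgP/commute_sym.
have [Q [p [p_surj p_ker']]] :=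
  quotient_exists (is_subgroup_range (expgz_hom h')) Nnormal.
have p_ker x : p x = 1%g <-> exists n, expgz h' n = x.
  split=> [/p_ker'[n _ En]|[n En]]; first by exists n.
  by apply/p_ker'; exists n.
have Q_torsion (q : Q) : exists n, (q ^+ n.+1 = 1)%g.
  have [x <-] := p_surj q.
  have [|i [j [i0 Eij]]] := @commuting_dependent G h (sval x) tf bs h1.
    by have /(congr1 sval)/= := hC x; rewrite Eh => /esym.
  apply: (expgz_eq1 i0); rewrite -hom_expgz; apply/p_ker; exists j.
  apply: (@subgroup_incl_inj _ _ gg).
  by rewrite !hom_expgz /= Eh -Eij.
have [[l lP]|inf] := pselect (exists l : seq Q, forall q, q \in l).
  have := finite_central_quotient_abelian K_tf hC h'1 p_surj p_ker Q_torsion lP.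
  by move=> /(_ g' k')/(congr1 sval) /=; rewrite Eg Ek.
case: (@central_torsion_absurd K S R h' K_gen K_tf hC h'1 Q p p_surj p_ker
  Q_torsion) => l.
apply: contrapT => nl; apply: inf; exists l => q; apply/negPn/negP => ql.
by apply: nl; exists q.
Qed.

(** * Submodules of free modules *)

Section Span.
Variables (L : groupType) (M : gmodule L).

Inductive gspan (A : set M) : M -> Prop :=
  | GSpanGen g v : A v -> gspan A (gmod_act M g v)
  | GSpan0 : gspan A 0
  | GSpanB u v : gspan A u -> gspan A v -> gspan A (u - v).

Lemma gspanN (A : set M) v : gspan A v -> gspan A (- v).
Proof. by move=> Av; rewrite -sub0r; apply: GSpanB => //; exact: GSpan0. Qed.

Lemma gspanD (A : set M) u v : gspan A u -> gspan A v -> gspan A (u + v).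
Proof. by move=> Au Av; rewrite -[v]opprK; apply: GSpanB => //; exact: gspanN. Qed.

Lemma gspanJ (A : set M) g v : gspan A v -> gspan A (gmod_act M g v).
Proof.
elim=> {v} [k v Av||u v _ Au _ Av].
- by rewrite -gmod_actM; exact: GSpanGen.
- by rewrite raddf0; exact: GSpan0.
- by rewrite raddfB; exact: GSpanB.
Qed.

Lemma gspan_diff (A : set M) g v : gspan A v -> gspan A (gmod_diff g v).
Proof. by move=> Av; apply: GSpanB => //; exact: gspanJ. Qed.

Lemma gspan_sub (A B : set M) v : A `<=` B -> gspan A v -> gspan B v.
Proof.
move=> AB; elim=> {v} [k v Av||u v _ Au _ Av]; [|exact: GSpan0|exact: GSpanB].
exact/GSpanGen/AB.
Qed.

(** The action of the product of the elements [b - 1] of the group ring. *)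
Definition diffs (bs : seq L) (v : M) : M := foldr (@gmod_diff L M) v bs.

Lemma diffsB bs u v : diffs bs (u - v) = diffs bs u - diffs bs v.
Proof. by elim: bs => //= b bs ->; rewrite gmod_diffB. Qed.
Lemma diffs0 bs : diffs bs 0 = 0.
Proof. by elim: bs => //= b bs ->; rewrite gmod_diff0. Qed.
Lemma diffsN bs v : diffs bs (- v) = - diffs bs v.
Proof. by rewrite -sub0r diffsB diffs0 sub0r. Qed.
Lemma diffsD bs u v : diffs bs (u + v) = diffs bs u + diffs bs v.
Proof. by rewrite -[v]opprK diffsB (diffsN bs (- v)). Qed.
Lemma diffs_cat bs bs' v : diffs (bs ++ bs') v = diffs bs (diffs bs' v).
Proof. exact: foldr_cat. Qed.

Lemma diffsC bs bs' v : {in bs & bs', forall b b', commute b b'} ->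
  diffs bs (diffs bs' v) = diffs bs' (diffs bs v).
Proof.
elim: bs => //= b bs IHbs cbb'.
rewrite IHbs => [|x y xb yb]; last by apply: cbb'; rewrite ?inE ?xb ?orbT.
elim: bs' {IHbs} cbb' => //= b' bs' IHbs' cbb'.
rewrite gmod_diffC; last by apply: cbb'; exact: mem_head.
by rewrite IHbs' // => x y xb yb; apply: cbb'; rewrite ?inE ?yb ?orbT.
Qed.

Lemma gspan_diffs (A : set M) bs v : gspan A v -> gspan A (diffs bs v).
Proof. by move=> Av; elim: bs => //= b bs; exact: gspan_diff. Qed.

End Span.

Lemma hom_diffs (L : groupType) (M N : gmodule L) (f : gmod_hom M N) bs v :
  f (diffs bs v) = diffs bs (f v).
Proof. by elim: bs => //= b bs <-; rewrite gmod_diff_hom. Qed.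

Lemma gspan_hom (L : groupType) (M N : gmodule L) (f : gmod_hom M N)
  (A : set M) v : gspan A v -> gspan (f @` A) (f v).
Proof.
elim=> {v} [g v Av||u v _ Au _ Av].
- by rewrite gmod_homJ; apply: GSpanGen; exists v.
- by rewrite raddf0; exact: GSpan0.
- by rewrite raddfB; exact: GSpanB.
Qed.

Lemma gspan_hom_lift (L : groupType) (M N : gmodule L) (f : gmod_hom M N)
  (A : set M) v : gspan (f @` A) v -> exists2 w, gspan A w & f w = v.
Proof.
elim=> {v} [g _ [w Aw <-]||_ _ _ [w Aw <-] _ [w' Aw' <-]].
- by exists (gmod_act M g w); [exact: GSpanGen | exact: gmod_homJ].
- by exists 0; [exact: GSpan0 | exact: raddf0].
- by exists (w - w'); [exact: GSpanB | exact: raddfB].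
Qed.

Section FreeSpan.
Variables (L : groupType) (Y : choiceType).
Local Notation F := (free_gmod L Y).

Lemma gspan_free (A : set F) (v : F) :
  (forall y k, coeff (y, k) v != 0 -> A (delta (y, 1%g))) -> gspan A v.
Proof.
move=> vA; rewrite -[v]freeg_sumE big_seq.
elim/big_ind: _ => [|u w|[y k] yv]; [exact: GSpan0|exact: gspanD|].
have Ay : A (delta (y, 1%g)) by apply: (vA y k); rewrite -mem_dom.
have Dy : gspan A (delta (y, k)) by rewrite free_gmod_deltaE; exact: GSpanGen.
have Pn (n : nat) : gspan A << n%:Z *g (y, k) >>.
  elim: n => [|n IHn]; first by rewrite freegU0; exact: GSpan0.
  by rewrite -addn1 PoszD -freegUD; exact: gspanD.
by case: (coeff _ _) => n; rewrite ?NegzE -?freegUN //; exact: gspanN.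
Qed.

Definition coord (y : Y) : gmod_hom F (free_gmod L unit) :=
  free_lift (M := free_gmod L unit)
    (fun y' => if y' == y then delta (tt, 1%g) else 0).

Lemma coeff_coord y k (v : F) : coeff (tt, k) (coord y v) = coeff (y, k) v.
Proof.
elim/freeg_ind: v => [[y' g]||u w Eu Ew|u Eu].
- rewrite free_lift_delta coeff_delta xpair_eqE.
  case: (y' == y); last by rewrite raddf0 coeff0.
  by rewrite free_gmod_delta mulg1 coeff_delta xpair_eqE.
- by rewrite raddf0 !coeff0.
- by rewrite raddfD !coeffD Eu Ew.
- by rewrite raddfN !coeffN Eu.
Qed.

End FreeSpan.
Arguments coord : simpl never.

(** * Relation modules *)

Section RelationModule.
Variables (L : groupType) (R : resolution2 L) (X : choiceType) (c : X -> L).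
Hypothesis c_gen : gen (range c) = setT.

Local Notation C0 := (free_gmod L unit).
Local Notation C1 := (free_gmod L X).
Local Notation P0 := (res0 R).
Local Notation P1 := (res1 R).
Local Notation P2 := (res2 R).
Local Notation d1 := (res_d1 R).
Local Notation d2 := (res_d2 R).
Local Notation eps := (res_eps R).

(** The boundary of the Cayley graph; its kernel is the relation module. *)
Definition cayley_d : gmod_hom C1 C0 :=
  free_lift (M := C0) (fun x => delta (tt, c x) - delta (tt, 1%g)).

Lemma cayley_d_delta x g :
  cayley_d (delta (x, g)) = delta (tt, (g * c x)%g) - delta (tt, g).
Proof. by rewrite free_lift_delta raddfB !free_gmod_delta mulg1. Qed.

Definition aug : {additive C0 -> int} := freeg_lift (fun _ => 1).

Lemma aug_delta g : aug (delta (tt, g)) = 1. Proof. exact: freeg_lift_delta. Qed.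

Lemma augJ g v : aug (gmod_act C0 g v) = aug v.
Proof.
have : aug \o gmod_act C0 g =1 aug.
  apply: freeg_additive_eq => -[[] k].
  by rewrite [LHS]/= -/(gmod_act C0 g _) free_gmod_delta !aug_delta.
by apply.
Qed.

Lemma aug_d w : aug (cayley_d w) = 0.
Proof.
elim/freeg_ind: w => [[x g]||u v Eu Ev|u Eu].
- by rewrite cayley_d_delta raddfB !aug_delta.
- by rewrite !raddf0.
- by rewrite !raddfD Eu Ev.
- by rewrite [cayley_d _]raddfN [aug _]raddfN Eu oppr0.
Qed.

Lemma aug_ker v : aug v = 0 -> exists w, cayley_d w = v.
Proof.
have dg g : exists w, cayley_d w = delta (tt, g) - delta (tt, 1%g).
  have : gen (range c) g by rewrite c_gen.
  move: g; apply: (@gen_ind _ _ (fun g =>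
    exists w, cayley_d w = delta (tt, g) - delta (tt, 1%g))) =>
    [|_ [x _ <-]|g k [u Eu] [u' Eu']|g [u Eu]].
  - by exists 0; rewrite raddf0 subrr.
  - by exists (delta (x, 1%g)); rewrite cayley_d_delta mul1g.
  - exists (u + gmod_act C1 g u'); rewrite raddfD gmod_homJ Eu Eu' raddfB.
    by rewrite !free_gmod_delta mulg1 addrC subrKA.
  - exists (- gmod_act C1 g^-1%g u); rewrite raddfN gmod_homJ Eu raddfB.
    by rewrite !free_gmod_delta mulg1 mulVg opprB.
suff [w Ew] : exists w, cayley_d w = v - delta (tt, 1%g) *~ aug v.
  by move=> v0; exists w; rewrite Ew v0 mulr0z subr0.
elim/freeg_ind: v => [[[] g]||u v [w Ew] [w' Ew']|u [w Ew]].
- by have [w Ew] := dg g; exists w; rewrite aug_delta.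
- by exists 0; rewrite [cayley_d 0]raddf0 [aug 0]raddf0 mulr0z subr0.
- exists (w + w'); rewrite [cayley_d _]raddfD Ew Ew' [aug (u + v)]raddfD mulrzDr.
  by rewrite opprD addrACA.
- by exists (- w); rewrite [cayley_d _]raddfN [aug (- u)]raddfN Ew mulrNz opprD.
Qed.

(** The relation module is a retract of [P2 + C1], because chain maps between the
    resolution and the Cayley complex are inverse to each other up to homotopy; so it
    is projective when [L] has cohomological dimension at most 2. The retraction is
    [(v, x) |-> phi v + e x] and its section is [w |-> (kappa w, w)]. *)
Lemma relation_module_projective : exists (Y : choiceType)
    (phi : gmod_hom (free_gmod L Y) C1) (e : gmod_hom C1 C1)
    (kappa : C1 -> free_gmod L Y),
  [/\ forall v, cayley_d (phi v) = 0,
      forall x, cayley_d (e x) = 0,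
      forall w, cayley_d w = 0 -> w = phi (kappa w) + e w,
      forall w w', cayley_d w = 0 -> cayley_d w' = 0 ->
        kappa (w - w') = kappa w - kappa w' &
      forall g w, cayley_d w = 0 ->
        kappa (gmod_act C1 g w) = gmod_act (free_gmod L Y) g (kappa w)].
Proof.
have [p0 Ep0] := res_eps_surj R.
pose f0 : gmod_hom C0 P0 := free_lift (fun _ => p0).
have epsf0 v : eps (f0 v) = aug v.
  elim/freeg_ind: v => [[[] g]||u v Eu Ev|u Eu].
  - by rewrite free_lift_delta res_epsJ Ep0 aug_delta.
  - by rewrite !raddf0.
  - by rewrite !raddfD Eu Ev.
  - by rewrite [f0 _]raddfN [eps _]raddfN [aug _]raddfN Eu.
have [|f1 f1P] := retract_lift (p := d1) (f := gmod_comp f0 cayley_d) (free_retract _ _).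
  by move=> v; apply/res_ker_eps; rewrite [LHS]epsf0 aug_d.
pose augZ : gmod_hom C0 (trivial_gmodule L) := @GModHom L C0 (trivial_gmodule L) aug augJ.
pose epsZ : gmod_hom P0 (trivial_gmodule L) :=
  @GModHom L P0 (trivial_gmodule L) eps (@res_epsJ L R).
have [|g0 g0P] := retract_lift (p := augZ) (f := epsZ) (res0_retract R).
  move=> v; exists (delta (tt, 1%g) *~ eps v).
  by rewrite [LHS](raddfMz aug) aug_delta intz.
have {}g0P v : aug (g0 v) = eps v by exact: g0P.
have epsd1 y : eps (d1 y) = 0 by apply/res_ker_eps; exists y.
have [|g1 g1P] := retract_lift (p := cayley_d) (f := gmod_comp g0 d1) (res1_retract R).
  by move=> v; apply: aug_ker; rewrite [LHS]g0P epsd1.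
have [|s0 s0P] := retract_lift (p := cayley_d)
    (f := gmod_sub (gmod_id C0) (gmod_comp g0 f0)) (free_retract _ _).
  by move=> v; apply: aug_ker; rewrite [LHS](raddfB aug)
    [aug (gmod_comp _ _ _)]g0P epsf0 subrr.
have [Y [i2 [r2 i2K]]] := res2_retract R.
pose e := gmod_sub (gmod_sub (gmod_id C1) (gmod_comp g1 f1)) (gmod_comp s0 cayley_d).
have eE x : e x = x - g1 (f1 x) - s0 (cayley_d x) by [].
pose phi := gmod_comp g1 (gmod_comp d2 r2).
have Zex w : exists v, cayley_d w = 0 -> exists2 z, f1 w = d2 z & v = i2 z.
  have [w0|nw0] := pselect (cayley_d w = 0); last by exists 0.
  have [|z Ez] := (res_ker_d1 (f1 w)).1; first by rewrite f1P /= w0 raddf0.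
  by exists (i2 z) => _; exists z.
have /choice[kappa kP] := Zex.
exists Y, phi, e, kappa; split.
- move=> v; rewrite g1P /=.
  by rewrite (_ : d1 _ = 0) ?raddf0 //; apply/res_ker_d1; exists (r2 v).
- move=> x; rewrite eE !raddfB g1P s0P /= f1P /=.
  by rewrite opprB addrC subrKA subrr.
- move=> w w0; have [z Ez Ek] := kP w w0.
  by rewrite Ek eE /phi /= i2K -Ez w0 raddf0 subr0 addrC subrK.
- move=> w w' w0 w'0; have [z Ez ->] := kP w w0; have [z' Ez' ->] := kP w' w'0.
  have [|y Ey ->] := kP (w - w'); first by rewrite raddfB w0 w'0 subrr.
  by rewrite -raddfB; congr (i2 _); apply: (@res_d2_inj _ R); rewrite -Ey !raddfB Ez Ez'.
- move=> g w w0; have [z Ez ->] := kP w w0.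
  have [|y Ey ->] := kP (gmod_act C1 g w); first by rewrite gmod_homJ w0 raddf0.
  rewrite -gmod_homJ; congr (i2 _); apply: (@res_d2_inj _ R).
  by rewrite -Ey !gmod_homJ Ez.
Qed.

End RelationModule.
Arguments cayley_d : simpl never.

(** * Abelian-by-cyclic groups with two generators *)

Section AbelianByCyclic.
Variables (L : groupType) (R : resolution2 L) (a t : L).
Variable deg : group_hom L Zgroup.
Hypotheses (L_tf : torsion_free L) (a1 : a <> 1%g)
  (L_gen : gen [set` [:: a; t]] = setT)
  (deg_a : deg a = 0 :> int) (deg_t : deg t = 1 :> int)
  (ker_abelian : forall x y, deg x = 0 :> int -> deg y = 0 :> int -> commute x y).

Local Notation C0 := (free_gmod L unit).
Local Notation C1 := (free_gmod L bool).

Definition ab_gen (b : bool) : L := if b then t else a.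
Local Notation d := (cayley_d ab_gen).

Let degM x y : deg (x * y)%g = deg x + deg y :> int.
Proof. by rewrite [LHS]gmulfM. Qed.
Let degV x : deg x^-1%g = - deg x :> int.
Proof. by rewrite [LHS]gmulfV. Qed.
Let degtX i : deg (t ^+ i)%g = i%:Z :> int.
Proof.
elim: i => [|i IHi]; first by rewrite [LHS]gmulf1.
by rewrite expgS degM deg_t IHi -add1n PoszD.
Qed.
Let deg1 : deg 1%g = 0 :> int. Proof. by rewrite [LHS]gmulf1. Qed.

Definition a_ (i : nat) : L := (t ^+ i * a * t ^- i)%g.

Let deg_a_ i : deg (a_ i) = 0 :> int.
Proof. by rewrite !degM degV deg_a addr0 subrr. Qed.
Let a_neq1 i : a_ i <> 1%g.
Proof. by move/eqP; rewrite /a_ mulg_eq1 invgK -{2}[(t ^+ i)%g]mulg1 => /eqP/mulgI. Qed.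
Let a_t i : (a_ i * t ^+ i = t ^+ i * a)%g. Proof. exact: mulgVK. Qed.

Let ab_gen_gen : gen (range ab_gen) = setT.
Proof.
rewrite -L_gen; congr gen; apply/seteqP; split=> [_ [[] _ <-]|x] /=.
- by rewrite !inE eqxx orbT.
- by rewrite !inE eqxx.
- by rewrite !inE => /orP[]/eqP ->; [exists false | exists true].
Qed.

Local Notation pr := (@coord L bool true).

Lemma coord_delta (b : bool) g :
  pr (delta (b, g)) = if b then delta (tt, g) else 0.
Proof.
rewrite free_lift_delta; case: b => /=; last exact: raddf0.
by rewrite -/(gmod_act C0 g _) free_gmod_delta mulg1.
Qed.

Lemma coeff_cayley_d g w : coeff (tt, g) (d w) =
  coeff (true, (g * t^-1)%g) w - coeff (true, g) w +
  (coeff (false, (g * a^-1)%g) w - coeff (false, g) w).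
Proof.
have aux (x k : L) (y : L) : (k * x == y)%g = (k == y * x^-1)%g.
  by rewrite -[RHS](inj_eq (@mulIg _ x)) mulgVK.
elim/freeg_ind: w => [[b k]||u v Eu Ev|u Eu].
- rewrite cayley_d_delta coeffB !coeff_delta !xpair_eqE /=.
  by case: b; rewrite /= aux ?subr0 ?addr0 ?add0r.
- by rewrite !raddf0 ?coeff0 ?subr0 ?addr0.
- rewrite raddfD !coeffD Eu Ev; lia.
- rewrite raddfN !coeffN Eu; lia.
Qed.

(** As [a - 1] is not a zero divisor in the group ring, the coordinate at [t]
    determines a relation. *)
Lemma relation_coord_inj w : d w = 0 -> pr w = 0 -> w = 0.
Proof.
move=> dw pw; have tw g : coeff (true, g) w = 0.
  by rewrite -coeff_coord pw coeff0.
have aw g : coeff (false, (g * a^-1)%g) w = coeff (false, g) w.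
  have := coeff_cayley_d g w; rewrite dw coeff0 !tw subrr add0r.
  by move/eqP; rewrite eq_sym subr_eq0 => /eqP.
apply: freegP => -[[] g]; rewrite coeff0 ?tw //.
have awn n : coeff (false, (g * a ^- n)%g) w = coeff (false, g) w.
  elim: n => [|n IHn]; first by rewrite invg1 mulg1.
  by rewrite expgS invgM mulgA aw IHn.
have [|n] := @avoid_finite _ (fun n => (false, (g * a ^- n)%g)) (dom w).
  move=> m n [/mulgI/invg_inj E].
  by have /(expgz_inj L_tf a1)[] : expgz a m = expgz a n := E.
by rewrite mem_dom negbK awn => /eqP.
Qed.

(** The element of the relation module that comes from the relator expressing that
    [a] and [a_ s.+1] commute. Its coordinate at [t] is
    [(a - 1) * (a_ s.+1 - 1) * (1 + t + ... + t ^ s)]. *)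
Definition commutator_relation (s : nat) : C1 :=
  \sum_(i < s.+1) gmod_diff a (gmod_diff (a_ s.+1) (delta (true, (t ^+ i)%g) : C1))
  + gmod_diff (a_ s.+1) (delta (false, 1%g) : C1)
  - gmod_diff a (delta (false, (t ^+ s.+1)%g) : C1).

Lemma commutator_relationP s : d (commutator_relation s) = 0.
Proof.
rewrite /commutator_relation raddfB raddfD raddf_sum.
under eq_bigr do rewrite !gmod_diff_hom cayley_d_delta.
rewrite !gmod_diff_hom !cayley_d_delta /ab_gen mul1g.
have diff_sum (b : L) n (F : nat -> C0) :
    \sum_(i < n) gmod_diff b (F i) = gmod_diff b (\sum_(i < n) F i).
  elim: n => [|n IHn]; first by rewrite !big_ord0 gmod_diff0.
  by rewrite !big_ord_recr /= IHn gmod_diffD.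
pose F (i : nat) : C0 := delta (tt, (t ^+ i * t)%g) - delta (tt, (t ^+ i)%g).
rewrite (diff_sum _ _ (fun i => gmod_diff (a_ s.+1) (F i))) (diff_sum _ _ F).
pose u i : C0 := delta (tt, (t ^+ i)%g).
have -> : \sum_(i < s.+1) F i = u s.+1 - u 0%N.
  elim: s => [|n IHn]; first by rewrite big_ord_recr [LHS]/= big_ord0 [LHS]add0r /F mul1g.
  by rewrite big_ord_recr /= IHn /F -expgSr addrC subrKA.
have -> : delta (tt, a) - delta (tt, 1%g) = gmod_diff a (u 0%N) :> C0.
  by rewrite /gmod_diff free_gmod_delta mulg1.
have -> : delta (tt, (t ^+ s.+1 * a)%g) - delta (tt, (t ^+ s.+1)%g) =
    gmod_diff (a_ s.+1) (u s.+1) :> C0.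
  by rewrite /gmod_diff free_gmod_delta a_t.
rewrite (gmod_diffC _ (ker_abelian (deg_a_ s.+1) deg_a)) !gmod_diffB.
by rewrite subrK subrr.
Qed.

Lemma coord_commutator_relation s : pr (commutator_relation s) =
  \sum_(i < s.+1) gmod_diff a (gmod_diff (a_ s.+1) (delta (tt, (t ^+ i)%g) : C0)).
Proof.
have pr0 b g : pr (gmod_diff b (delta (false, g) : C1)) = 0.
  by rewrite gmod_diff_hom coord_delta gmod_diff0.
rewrite /commutator_relation raddfB raddfD raddf_sum !pr0 subr0 addr0.
by apply: eq_bigr => i _; rewrite !gmod_diff_hom coord_delta.
Qed.

(** For these [b] the elements [b - 1] of the group ring are commuting non zero
    divisors. *)
Definition kernel_list (bs : seq L) := forall b, b \in bs -> deg b = 0 :> int /\ b <> 1%g.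

Lemma kernel_diffs_inj bs (v : C0) : kernel_list bs -> diffs bs v = 0 -> v = 0.
Proof.
elim: bs => //= b bs IHbs bP bv; apply: IHbs.
  by move=> x xbs; apply: bP; rewrite inE xbs orbT.
apply: free_diff_inj bv => //.
by have [] := bP b (mem_head _ _).
Qed.

(** For the basis element [g], multiplication by [b - 1] for the two conjugates
    [b = g * a * g^-1] and [b = g * a_ 1 * g^-1] gives [g * (a - 1) * (a_ 1 - 1)], a
    multiple of the first commutator relation. *)
Lemma coord_torsion (v : C0) : exists2 bs, kernel_list bs &
  gspan [set pr (commutator_relation 0)] (diffs bs v).
Proof.
elim/freeg_ind: v => [[[] g]||u v [bs bP bu] [cs cP cv]|u [bs bP bu]].
- exists [:: (a ^ g^-1)%g; (a_ 1 ^ g^-1)%g].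
    have JP b : deg b = 0 :> int -> b <> 1%g ->
        deg (b ^ g^-1)%g = 0 :> int /\ (b ^ g^-1)%g <> 1%g.
      move=> b0 b1; split; last by move/eqP; rewrite conjg_eq1 => /eqP.
      by rewrite conjgE invgK !degM degV b0 add0r subrr.
    by move=> b; rewrite !inE => /orP[]/eqP ->; apply: JP.
  have diffJ b (w : C0) :
      gmod_diff (b ^ g^-1)%g (gmod_act C0 g w) = gmod_act C0 g (gmod_diff b w).
    rewrite /gmod_diff raddfB -!gmod_actM; congr (gmod_act _ _ _ - _).
    by rewrite conjgE invgK -!mulgA mulVg mulg1.
  have -> : diffs [:: (a ^ g^-1)%g; (a_ 1 ^ g^-1)%g] (delta (tt, g) : C0) =
      gmod_act C0 g (gmod_diff a (gmod_diff (a_ 1) (delta (tt, 1%g) : C0))).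
    by rewrite -!diffJ free_gmod_delta mulg1.
  apply: GSpanGen; by rewrite coord_commutator_relation big_ord1.
- by exists [::] => //; exact: GSpan0.
- exists (bs ++ cs); first by move=> b; rewrite mem_cat => /orP[/bP|/cP].
  have cbc : {in bs & cs, forall b c, commute b c}.
    by move=> b c /bP[b0 _] /cP[c0 _]; exact: ker_abelian.
  rewrite diffsD; apply: gspanD; rewrite diffs_cat; last exact: gspan_diffs.
  by rewrite diffsC //; exact: gspan_diffs.
- by exists bs => //; rewrite diffsN; exact: gspanN.
Qed.

(** The relation module is projective of rank one, hence finitely generated: a
    coordinate of a projective basis that vanishes on one commutator relation
    vanishes everywhere, since every relation becomes a multiple of that one after
    multiplication by a non zero divisor. *)
Lemma relation_module_fg : exists ws : seq C1,
  (forall w, w \in ws -> d w = 0) /\ (forall w, d w = 0 -> gspan [set` ws] w).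
Proof.
have [Y [phi [e [kappa [dphi de kE kB kJ]]]]] :=
  relation_module_projective R ab_gen_gen.
pose z0 := commutator_relation 0.
have dz0 : d z0 = 0 by exact: commutator_relationP.
pose Y0 := [seq u.1 | u <- dom (kappa z0)].
have k0 : kappa 0 = 0.
  by have := kB 0 0 (raddf0 _) (raddf0 _); rewrite subr0 subrr.
have span_k w : gspan [set z0] w ->
    d w = 0 /\ forall y, y \notin Y0 -> coord L y (kappa w) = 0.
  elim=> {w} [g _ ->||u v _ [du ku] _ [dv kv]].
  - rewrite gmod_homJ dz0 raddf0; split=> // y yY; rewrite kJ // gmod_homJ.
    rewrite (_ : coord L y (kappa z0) = 0) ?raddf0 //.
    apply: freegP => -[[] k]; rewrite coeff_coord coeff0.
    apply: contraNeq yY => nz; apply/mapP; exists (y, k) => //.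
    by rewrite mem_dom.
  - by rewrite raddf0; split=> // y _; rewrite k0 raddf0.
  - rewrite raddfB du dv subrr; split=> // y yY.
    by rewrite kB // raddfB ku // kv // subrr.
have diffs_k bs w : d w = 0 ->
    d (diffs bs w) = 0 /\ kappa (diffs bs w) = diffs bs (kappa w).
  move=> dw; elim: bs => // b bs [IH1 IH2].
  rewrite -![diffs (b :: bs) _]/(gmod_diff b (diffs bs _)) gmod_diff_hom IH1.
  rewrite gmod_diff0; split=> //.
  by rewrite /gmod_diff kB ?kJ ?IH2 // gmod_homJ IH1 raddf0.
have supp w : d w = 0 -> forall y, y \notin Y0 -> coord L y (kappa w) = 0.
  move=> dw y yY; have [bs bP sp] := coord_torsion (pr w).
  have [|w0 sw0 Ew0] := @gspan_hom_lift _ _ _ pr [set z0] (diffs bs (pr w)).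
    by apply: gspan_sub sp => _ ->; exists z0.
  have [dw0 kw0] := span_k w0 sw0; have [dbw kbw] := diffs_k bs w dw.
  have E : diffs bs w = w0.
    apply/eqP; rewrite -subr_eq0; apply/eqP; apply: relation_coord_inj.
      by rewrite raddfB dbw dw0 subrr.
    by rewrite raddfB hom_diffs Ew0 subrr.
  apply: (kernel_diffs_inj bP); rewrite -hom_diffs -kbw E; exact: kw0.
exists ([seq phi (delta (y, 1%g)) | y <- Y0] ++
        [seq e (delta (b, 1%g)) | b <- [:: true; false]]).
split=> [w|w dw].
  by rewrite mem_cat => /orP[]/mapP[? _ ->].
rewrite (kE w dw); apply: gspanD.
  have : gspan [set (delta (y, 1%g) : free_gmod L Y) | y in [set` Y0]] (kappa w).
    apply: gspan_free => y k nz; exists y => //=.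
    by apply: contraNT nz => /(supp w dw) E; rewrite -coeff_coord E coeff0.
  move/(gspan_hom phi); apply: gspan_sub => _ [_ [y yY <-] <-] /=.
  by rewrite mem_cat; apply/orP; left; apply/mapP; exists y.
have : gspan [set (delta (b, 1%g) : C1) | b in [set: bool]] w.
  by apply: gspan_free => b k _; exists b.
move/(gspan_hom e); apply: gspan_sub => _ [_ [b _ <-] <-] /=.
by rewrite mem_cat !inE; case: b; rewrite eqxx ?orbT.
Qed.

Section Trace.
Variable s : nat.

Let C : set L := gen [set` [seq a_ i.+1 | i <- iota 0 s]].
Let Cgrp : is_subgroup C := gen_subgroup _.

Let deg_C x : C x -> deg x = 0 :> int.
Proof.
move: x; apply: gen_ind => [|x|x y x0 y0|x x0] //.
- by move=> /mapP[i _ ->].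
- by rewrite degM x0 y0.
- by rewrite degV x0 oppr0.
Qed.

Definition coset_trace (i : nat) : {additive C0 -> int} :=
  freeg_lift (fun u : unit * L => (`[< C (u.2 * t ^- i)%g >])%:R).

Lemma coset_trace_delta i g :
  coset_trace i (delta (tt, g)) = (`[< C (g * t ^- i)%g >])%:R.
Proof. exact: freeg_lift_delta. Qed.

(** Right multiplication by [a] preserves the coset [C t ^ i], because [a_ i] lies in
    [C]. So only the coordinate at [t] contributes to the trace of the boundary, and
    it compares neighbouring cosets. *)
Lemma coset_trace_d i w : (0 < i <= s)%N ->
  coset_trace i (d w) = coset_trace i.-1 (pr w) - coset_trace i (pr w).
Proof.
case: i => //= i i_s.
have Ca : C (a_ i.+1).
  by apply: sub_gen => /=; apply/mapP; exists i; rewrite // mem_iota.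
elim/freeg_ind: w => [[b g]||u v Eu Ev|u Eu].
- rewrite cayley_d_delta coord_delta raddfB; case: b; rewrite !coset_trace_delta /=.
    by congr (_ - _); rewrite expgSr invgM mulgA mulgK.
  rewrite !raddf0 subr0; apply/eqP; rewrite subr_eq0; apply/eqP; congr (_%:R).
  congr nat_of_bool; apply: asbool_equiv_eq.
  have -> : (g * a * t ^- i.+1 = g * t ^- i.+1 * a_ i.+1)%g.
    by rewrite /a_ !mulgA mulgVK.
  split=> Cg; last exact: (subgroupM Cgrp).
  by rewrite -[(g * _)%g](mulgK (a_ i.+1)); exact: (subgroupF Cgrp).
- by rewrite !raddf0 subr0.
- rewrite !raddfD /= Eu Ev; lia.
- rewrite [d _]raddfN [coset_trace _ (- d u)]raddfN Eu [pr (- u)]raddfN.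
  rewrite [coset_trace i (- pr u)]raddfN [coset_trace i.+1 (- pr u)]raddfN.
  by rewrite opprB opprK addrC.
Qed.

Lemma coset_trace_relation w : d w = 0 -> coset_trace 0 (pr w) = coset_trace s (pr w).
Proof.
move=> dw.
suff tr i : (i <= s)%N -> coset_trace 0 (pr w) = coset_trace i (pr w) by exact: tr.
elim: i => // i IHi le_is; rewrite IHi 1?ltnW //.
have := @coset_trace_d i.+1 w le_is; rewrite dw raddf0 /= => /esym/eqP.
by rewrite subr_eq0 => /eqP.
Qed.

Lemma coset_trace_neq0 i (v : C0) : coset_trace i v <> 0 ->
  exists g, coeff (tt, g) v != 0 /\ deg g = i%:Z :> int.
Proof.
move=> nz; apply: contrapT => nex; apply: nz.
rewrite -[v]freeg_sumE raddf_sum big_seq big1 // => -[[] g]; rewrite mem_dom => vg.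
have -> : << coeff (tt, g) v *g (tt, g) >> = delta (tt, g) *~ coeff (tt, g) v.
  by rewrite /delta freegU_mulz intz.
rewrite raddfMz /= coset_trace_delta.
case: asboolP => [/deg_C|_]; last by rewrite mul0rz.
rewrite degM degV degtX => /eqP; rewrite subr_eq0 => /eqP E.
by case: nex; exists g.
Qed.

(** A translate of a relation supported in degrees between [- k] and [k] has no room
    for both cosets, but its traces on them agree. *)
Lemma coset_trace_short (k : nat) w l : d w = 0 -> (k + k < s)%N ->
  (forall g, coeff (tt, g) (pr w) != 0 -> (`|deg g : int| <= k)%N) ->
  coset_trace 0 (pr (gmod_act C1 l w)) = 0.
Proof.
move=> dw ks kP; have dlw : d (gmod_act C1 l w) = 0 by rewrite gmod_homJ dw raddf0.
apply: contrapT => nz0; have nzs := nz0; rewrite (coset_trace_relation dlw) in nzs.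
have [g [+ Eg]] := coset_trace_neq0 nz0; have [h [+ Eh]] := coset_trace_neq0 nzs.
rewrite gmod_homJ !coeff_free_actV => /kP + /kP; rewrite !degM !degV Eg Eh.
lia.
Qed.

(** On the commutator relation of [a] and [a_ s.+1] the trace on [C] only sees the
    four terms of [(a - 1) * (a_ s.+1 - 1)], of which [1] is in [C] while [a] and
    [a_ s.+1] are not. *)
Lemma coset_trace_commutator : ~ C a -> ~ C (a_ s.+1) ->
  coset_trace 0 (pr (commutator_relation s)) <> 0.
Proof.
move=> Ca Cas.
have tr g : coset_trace 0 (delta (tt, g)) = (`[< C g >])%:R.
  by rewrite coset_trace_delta invg1 mulg1.
have tr0 g : ~ C g -> coset_trace 0 (delta (tt, g)) = 0.
  by move=> Cg; rewrite tr asboolF.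
have dd g : gmod_diff a (gmod_diff (a_ s.+1) (delta (tt, g) : C0)) =
    delta (tt, (a * (a_ s.+1 * g))%g) - delta (tt, (a * g)%g) -
    (delta (tt, (a_ s.+1 * g)%g) - delta (tt, g)) :> C0.
  by rewrite /gmod_diff raddfB !free_gmod_delta.
rewrite coord_commutator_relation raddf_sum big_ord_recl big1 => [|i _].
  rewrite /= dd !raddfB /= !mulg1 (tr0 a) // (tr0 (a_ s.+1)) // tr.
  by rewrite tr (asboolT (subgroup1 Cgrp)); case: asboolP.
have degC x : deg x <> 0 :> int -> ~ C x by move=> x0 /deg_C.
rewrite /= dd !raddfB /= /bump leq0n add1n.
by rewrite !tr0 ?subrr //; apply: degC; rewrite !(deg_a_, deg_a, degtX, add0r, degM).
Qed.

End Trace.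

(** The finitely many generators of the relation module have bounded degrees; a
    commutator relation between [a] and a far conjugate of [a] is a combination of
    them only if the conjugates in between account for [a] or for [a_ s.+1]. *)
Lemma a_in_conjugates : exists s,
  gen [set` [seq a_ i.+1 | i <- iota 0 s]] a \/
  gen [set` [seq a_ i.+1 | i <- iota 0 s]] (a_ s.+1).
Proof.
have [ws [dws ws_span]] := relation_module_fg.
have [k kP] : exists k : nat, forall w, w \in ws ->
    forall g, coeff (tt, g) (pr w) != 0 -> (`|deg g : int| <= k)%N.
  elim: ws {dws ws_span} => [|w ws [k kP]]; first by exists 0%N.
  pose m := \max_(u <- dom (pr w)) `|deg u.2 : int|%N.
  exists (m + k)%N => v; rewrite inE => /orP[/eqP ->|vws] g nz.
    apply: leq_trans (leq_addr _ _).
    apply: (@leq_bigmax_seq _ _ xpredT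
      (fun u : unit * L => `|deg u.2 : int|%N) (tt, g)) => //.
    by rewrite mem_dom.
  exact: leq_trans (kP v vws g nz) (leq_addl _ _).
pose s := (k + k).+1; exists s; apply: contrapT => /not_orP[Ca Cas].
apply: (coset_trace_commutator Ca Cas).
elim: (ws_span _ (commutator_relationP s)) => [g w wws||u v _ Eu _ Ev].
- by apply: (@coset_trace_short s k) => //; [exact: dws | exact: kP].
- by rewrite !raddf0.
- by rewrite !raddfB Eu Ev subrr.
Qed.

End AbelianByCyclic.

(** * Semidirect products of locally cyclic groups with the integers *)

Lemma hom_a_ (L S : groupType) (f : group_hom L S) a t i :
  f (a_ a t i) = a_ (f a) (f t) i.
Proof. by rewrite /a_ !gmulfM gmulfV !gmulfXn. Qed.

Section LocallyCyclicByCyclic.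
Variables (H : groupType) (phi : aut_action Zgroup H).
Local Notation S := (sdprod_of phi).

Definition sd_l (y : H) : S := (y, 1%g).
Definition sd_r : S := (1%g, 1 : Zgroup).

Lemma sd_lM : {morph sd_l : x y / (x * y)%g}.
Proof. by move=> x y; congr pair; rewrite /= aut_act1. Qed.

Fact sd_sndM : {morph (fun u : S => u.2 : Zgroup) : u v / (u * v)%g}.
Proof. by []. Qed.
Definition sd_deg : group_hom S Zgroup := hom_of_morph sd_sndM.

Lemma sd_conj y : (sd_r * sd_l y * sd_r^-1)%g = sd_l (phi 1 y).
Proof.
apply: (@mulIg _ sd_r); rewrite mulgVK; congr pair.
by rewrite /= mul1g gmulf1 mulg1.
Qed.

Lemma sd_conjX i y : (sd_r ^+ i * sd_l y * sd_r ^- i)%g = sd_l (phi i%:Z y).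
Proof.
elim: i => [|i IHi]; first by rewrite mul1g invg1 mulg1 aut_act1.
have -> : (sd_r ^+ i.+1 * sd_l y * sd_r ^- i.+1 =
    sd_r * (sd_r ^+ i * sd_l y * sd_r ^- i) * sd_r^-1)%g.
  by rewrite expgS invgM !mulgA.
by rewrite IHi sd_conj -aut_actM intS.
Qed.

Lemma aut_act_eq1 k y : phi k y = 1%g -> y = 1%g.
Proof.
move=> ky; rewrite -[y](aut_act1 phi) -(mulVg (k : Zgroup)) aut_actM ky.
exact: gmulf1.
Qed.

Hypotheses (resS : exists R : resolution2 S, True) (bs : BS_free S)
  (lc : locally_cyclic H).

Let S_tf : torsion_free S. Proof. exact: resolution_torsion_free. Qed.

Lemma locally_cyclic_abelian : abelian_group H.
Proof.
move=> x y; have [z Ez] := locally_cyclic_gen [:: x; y] lc.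
have inz w : w \in [:: x; y] -> range (expgz z) w.
  by move=> w_in; rewrite -Ez; exact: sub_gen.
have [i _ <-] := inz x (mem_head _ _).
have [j _ <-] : range (expgz z) y by apply: inz; rewrite !inE eqxx orbT.
exact: commute_expgz2.
Qed.

(** Otherwise [c] and a generator of the infinite cyclic factor would give a copy of
    [BS(1, n)]. *)
Lemma no_invariant_cyclic (c : H) (k : int) : k = 1 \/ k = -1 -> c <> 1%g ->
  ~ range (expgz c) (phi k c).
Proof.
move=> k1 c1 [n _ En].
have n0 : n <> 0.
  by move=> n0; apply: c1; apply: (@aut_act_eq1 k); rewrite -En n0.
pose u : S := if k == 1 then sd_r^-1%g else sd_r.
apply: (@contains_BS1 S (sd_l c) u n S_tf) bs => //.
- by case.
- rewrite -[sd_l c]/(hom_of_morph sd_lM c) -hom_expgz En.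
  rewrite /u; case: k1 => ->; first by rewrite conjgE invgK mulgA sd_conj.
  rewrite (_ : (-1 == 1 :> int) = false) //.
  have Ec : c = phi 1 (phi (-1) c) by rewrite -aut_actM; exact/esym/aut_act1.
  by rewrite {1}Ec /= -sd_conj conjgE !mulgA mulVg mul1g mulgVK.
- move=> i j /(congr1 sd_deg); rewrite !hom_expgz [sd_deg (sd_l c)]/= expgz1n.
  rewrite /u; case: ifP => _.
    rewrite gmulfV expgzVn => /(congr1 (fun z : Zgroup => z^-1%g)).
    by rewrite invgK => E; rewrite -[i]expgz_Zgroup; exact: E.
  by move=> E; rewrite -[i]expgz_Zgroup; exact: E.
Qed.

(** Let [c] generate the subgroup spanned by the conjugates of [x] by the powers
    [1], ..., [s] of the generator of the cyclic factor. If this subgroup contains [x]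
    or the conjugate by the power [s + 1], then conjugation by that generator, or by
    its inverse, maps [c] to a power of [c], which the previous lemma excludes. *)
Lemma locally_cyclic_factor_trivial (x : H) : x = 1%g.
Proof.
apply: contrapT => x1.
pose a := sd_l x; pose t := sd_r; pose gg := gen_subgroup [set` [:: a; t]].
pose L := subgroup_type gg.
have [gens [Egens L_gen]] := subgroup_type_gen [:: a; t].
case: gens Egens L_gen => [|a' [|t' [|? ?]]] //= [Ea Et] L_gen.
have [R _] := restrict_resolution (@subgroup_incl_inj _ _ gg) resS.
have L_tf : torsion_free L by apply: resolution_torsion_free; exists R.
pose deg := comp_hom sd_deg (subgroup_incl gg).
have degE u : deg u = (sval u).2 by [].
have ker_l (u : L) : deg u = 0 :> int -> sval u = sd_l (sval u).1.
  by rewrite degE; case: (sval u) => y k /= ->.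
have [||||s Hs] := @a_in_conjugates L R a' t' deg L_tf _ L_gen.
- by move=> E; apply: x1; have /(congr1 fst) : a = 1%g by rewrite -Ea E.
- by rewrite degE Ea.
- by rewrite degE Et.
- move=> u v /ker_l Eu /ker_l Ev; apply: subgroup_type_eq => /=.
  by rewrite Eu Ev -!sd_lM locally_cyclic_abelian.
pose hs := [seq phi i.+1%:Z x | i <- iota 0 s].
have hsP i : (i < s)%N -> gen [set` hs] (phi i.+1%:Z x).
  by move=> i_s; apply: sub_gen => /=; apply/mapP; exists i; rewrite ?mem_iota.
have gh := gen_subgroup [set` hs].
have a_E i : sval (a_ a' t' i) = sd_l (phi i%:Z x).
  rewrite -[LHS]/(subgroup_incl gg _) hom_a_.
  by rewrite [subgroup_incl gg a']Ea [subgroup_incl gg t']Et; exact: sd_conjX.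
have tr (u : L) : gen [set` [seq a_ a' t' i.+1 | i <- iota 0 s]] u ->
    exists2 y, gen [set` hs] y & sval u = sd_l y.
  move: u; apply: gen_ind => [|u /mapP[i i_s ->]|u v [y gy Ey] [z gz Ez]|u [y gy Ey]].
  - by exists 1%g => //; exact: gen1.
  - exists (phi i.+1%:Z x); last exact: a_E.
    by apply: hsP; move: i_s; rewrite mem_iota.
  - exists (y * z)%g; first exact: (subgroupM gh).
    by rewrite sd_lM -Ey -Ez.
  - exists y^-1%g; first exact: (subgroupV gh).
    by rewrite -[RHS]/(hom_of_morph sd_lM _) gmulfV -[RHS]/((sd_l y)^-1%g) -Ey.
have [c Ec] := locally_cyclic_gen hs lc.
have gc : gen [set` hs] c by rewrite Ec; exists 1.
have c1 y : gen [set` hs] y -> y <> 1%g -> c <> 1%g.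
  by rewrite Ec => -[n _ <-] + Ec1; rewrite Ec1 expgz1n.
have stable k : (forall i, (i < s)%N -> gen [set` hs] (phi k (phi i.+1%:Z x))) ->
    range (expgz c) (phi k c).
  move=> kP; rewrite -Ec; move: gc.
  apply: (gen_ind (P := fun y => gen [set` hs] (phi k y))).
  - by rewrite gmulf1; exact: gen1.
  - by move=> _ /= /mapP[i i_s ->]; apply: kP; move: i_s; rewrite mem_iota.
  - by move=> y z; rewrite gmulfM; exact: (subgroupM gh).
  - by move=> y; rewrite gmulfV; exact: (subgroupV gh).
case: Hs => /tr [y gy].
- rewrite Ea => /(congr1 fst) /= Ey; rewrite -Ey in gy.
  apply: (@no_invariant_cyclic c (-1)); [by right | exact: c1 gy x1|].
  apply: stable => i i_s; rewrite -aut_actM.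
  have -> : ((-1 : Zgroup) * (i.+1%:Z : Zgroup))%g = i%:Z :> int.
    by rewrite -[LHS]/(-1 + i.+1%:Z); lia.
  case: i i_s => [|i] i_s; first by rewrite aut_act1.
  by apply: hsP; exact: ltnW.
- rewrite a_E => /(congr1 fst) /= Ey; rewrite -Ey in gy.
  apply: (@no_invariant_cyclic c 1); [by left | apply: c1 gy _ => /aut_act_eq1//|].
  apply: stable => i i_s; rewrite -aut_actM.
  have -> : ((1%R : Zgroup) * (i.+1%:Z : Zgroup))%g = i.+2%:Z :> int.
    by rewrite -[LHS]/(1 + i.+1%:Z); lia.
  move: i_s; rewrite leq_eqVlt => /orP[/eqP i_s|]; last exact: hsP.
  by rewrite i_s.
Qed.

End LocallyCyclicByCyclic.

Lemma BS_free_AH (G : groupType) :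
  (exists R : resolution2 G, True) -> BS_free G -> algebraically_hyperbolic G.
Proof.
move=> resG bs; split.
- exact: resolution_torsion_free.
- exact: BS_free_commutative_transitive.
- move=> [H [phi [[x x1] lc GS]]]; apply: x1.
  have bsS : BS_free (sdprod_of phi).
    move=> [m [n [m0 n0 SB]]]; apply: bs; exists m, n; split=> //.
    exact: contains_subgroup_trans GS SB.
  have [f f_inj] := (contains_subgroupP _ _).1 GS.
  exact: (@locally_cyclic_factor_trivial _ phi (restrict_resolution f_inj resG)).
Qed.

Theorem theoremB (G : groupType) (hG : cohomological_dimension G 2) :
  [<-> algebraically_hyperbolic G;
       weakly_algebraically_hyperbolic G;
       BS_free G].
Proof.
have [cdG _] := hG.
tfae.
- exact: AH_weakly_AH.
- exact: weakly_AH_BS_free.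
- exact/BS_free_AH/cd_le2_resolution.
Qed.
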